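(* Let $m\ge 2$ and let $$K^\ast_{\ell_1} = \operatorname{cl}\{\mathbf{s}=(\mathbf{s}_1,\ldots,\mathbf{s}_m)\in\mathbb{R}^{U\times m} : \Lambda(\mathbf{s}_1)\succ 0,\ \Lambda(\mathbf{s}_1)-\Lambda(\mathbf{s}_i)\Lambda(\mathbf{s}_1)^{-1}\Lambda(\mathbf{s}_i)\succ 0\ \ \forall i\in\{2,\ldots,m\}\}.$$ Then the function $$F(\mathbf{s}) = -\sum_{i=2}^m \log\det\big(\Lambda(\mathbf{s}_1)-\Lambda(\mathbf{s}_i)\Lambda(\mathbf{s}_1)^{-1}\Lambda(\mathbf{s}_i)\big) - \log\det\Lambda(\mathbf{s}_1),$$ defined on the set where all these matrices are positive definite (the interior of $K^\ast_{\ell_1}$), is an $Lm$-logarithmically homogeneous self-concordant barrier for $K^\ast_{\ell_1}$.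
   Context: Fix integers $n,d\ge 1$, and set $L=\binom{n+d}{n}$, $U=\binom{n+2d}{n}$. Let $\mathbf{t}_1,\ldots,\mathbf{t}_U\in\mathbb{R}^n$ be points that are unisolvent for $\mathbb{R}[\mathbf{x}]_{n,2d}$ (the polynomials in $n$ variables of degree at most $2d$), i.e. a polynomial of degree at most $2d$ vanishing at all of them is zero, and let $p_1,\ldots,p_L$ be a basis of $\mathbb{R}[\mathbf{x}]_{n,d}$. Let $\mathbf{P}\in\mathbb{R}^{U\times L}$ with $P_{u,\ell}=p_\ell(\mathbf{t}_u)$, and define the linear map $\Lambda:\mathbb{R}^U\to\mathbb{S}^L$ by $\Lambda(\mathbf{s})=\mathbf{P}^\top\operatorname{Diag}(\mathbf{s})\mathbf{P}$, where $\mathbb{S}^L$ denotes the real symmetric $L\times L$ matrices. A function $F$ on the interior of a closed convex cone $K$ with nonempty interior is a $\nu$-logarithmically homogeneous self-concordant barrier ($\nu$-LHSCB) if it is $C^3$ and convex, $F(\mathbf{x}_k)\to\infty$ whenever $\mathbf{x}_k$ converges to a point on the boundary of $K$, $|D^3F(\mathbf{x})[\mathbf{h},\mathbf{h},\mathbf{h}]|\le 2\,(D^2F(\mathbf{x})[\mathbf{h},\mathbf{h}])^{3/2}$ for all interior $\mathbf{x}$ and all directions $\mathbf{h}$, and $F(\tau\mathbf{x})=F(\mathbf{x})-\nu\log\tau$ for all $\tau>0$. *)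

(* Defs.v *)
From HB Require Import structures.
From mathcomp Require Import all_boot all_order all_algebra.
From mathcomp Require Import all_classical all_reals all_analysis.
From mathcomp Require mpoly.
Import (canonicals, coercions) mpoly.

Set Implicit Arguments.
Unset Strict Implicit.
Unset Printing Implicit Defensive.

Import Order.TTheory GRing.Theory Num.Theory.
Import numFieldNormedType.Exports.
Local Open Scope classical_set_scope.
Local Open Scope ring_scope.

Definition deg_le (R : nzRingType) (n k : nat) (p : mpoly.mpoly n R) : bool :=
  all (fun mon => (mpoly.mdeg mon <= k)%N) (mpoly.msupp p).

Definition is_basis_polys (R : fieldType) (n d L : nat)
    (p : 'I_L -> mpoly.mpoly n R) : Prop :=
  [/\ forall l, deg_le d (p l),
      (forall c : 'I_L -> R, \sum_(l < L) c l *: p l = 0 -> forall l, c l = 0)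
    & forall q : mpoly.mpoly n R, deg_le d q ->
        exists c : 'I_L -> R, q = \sum_(l < L) c l *: p l].

Definition unisolvent (R : comNzRingType) (n k U : nat)
    (t : 'I_U -> 'I_n -> R) : Prop :=
  forall q : mpoly.mpoly n R, deg_le k q ->
    (forall u, mpoly.meval (t u) q = 0) -> q = 0.

Definition Pmat (R : comNzRingType) (n U L : nat)
    (t : 'I_U -> 'I_n -> R) (p : 'I_L -> mpoly.mpoly n R) : 'M[R]_(U, L) :=
  \matrix_(u < U, l < L) mpoly.meval (t u) (p l).

Definition Lam (R : comNzRingType) (U L : nat) (P : 'M[R]_(U, L))
    (s : 'cV[R]_U) : 'M[R]_L :=
  P^T *m diag_mx s^T *m P.

Definition posdef (R : realFieldType) (L : nat) (A : 'M[R]_L) : Prop :=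
  A^T = A /\ forall x : 'cV[R]_L, x != 0 -> 0 < (x^T *m A *m x) 0 0.

(* The block variable s = (s_1, ..., s_m) in R^{U x m}; s_i = column i. *)
Definition first_idx (m : nat) (hm : (2 <= m)%N) : 'I_m :=
  Ordinal (leq_trans (isT : (1 <= 2)%N) hm).

Section Cone.
Variables (R : realType) (U L m : nat) (P : 'M[R]_(U, L)) (hm : (2 <= m)%N).

Definition Lam1 (s : 'M[R]_(U, m)) : 'M[R]_L := Lam P (col (first_idx hm) s).

Definition schur (s : 'M[R]_(U, m)) (i : 'I_m) : 'M[R]_L :=
  Lam1 s - Lam P (col i s) *m invmx (Lam1 s) *m Lam P (col i s).

Definition Kint : set 'M[R]_(U, m) :=
  [set s | posdef (Lam1 s) /\
           forall i : 'I_m, i != first_idx hm -> posdef (schur s i)].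

Definition Kl1 : set 'M[R]_(U, m) := closure Kint.

Definition Fbar (s : 'M[R]_(U, m)) : R :=
  - (\sum_(i < m | i != first_idx hm) ln (\det (schur s i)))
  - ln (\det (Lam1 s)).

End Cone.

Section LHSCB.
Variables (R : realType) (V : normedModType R).

Definition C3_on (O : set V) (F : V -> R) : Prop :=
  forall v1 v2 v3 : V,
    [/\ {in O, forall x, derivable F x v1},
        {in O, forall x, derivable ('D_v1 F) x v2}
      & {in O, forall x, derivable ('D_v2 ('D_v1 F)) x v3}] /\
    [/\ {within O, continuous F},
        {within O, continuous ('D_v1 F)},
        {within O, continuous ('D_v2 ('D_v1 F))}
      & {within O, continuous ('D_v3 ('D_v2 ('D_v1 F)))}].

Definition convex_on (O : set V) (F : V -> R) : Prop :=
  forall x y : V, O x -> O y -> forall t : R, 0 <= t <= 1 ->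
    F (t *: x + (1 - t) *: y) <= t * F x + (1 - t) * F y.

Definition closed_convex_cone_int (K : set V) : Prop :=
  [/\ closed K,
      (forall x y : V, K x -> K y -> forall t : R, 0 <= t <= 1 ->
          K (t *: x + (1 - t) *: y)),
      (forall (x : V) (tau : R), K x -> 0 <= tau -> K (tau *: x))
    & interior K !=set0].

Definition D2 (F : V -> R) (x h : V) : R := 'D_h ('D_h F) x.
Definition D3 (F : V -> R) (x h : V) : R := 'D_h ('D_h ('D_h F)) x.

Definition LHSCB (nu : R) (K : set V) (F : V -> R) : Prop :=
  [/\ closed_convex_cone_int K,
      C3_on (interior K) F
    & convex_on (interior K) F] /\
  [/\
      (forall (xs : nat -> V) (x : V),
          (forall k, interior K (xs k)) -> xs @ \oo --> x ->
          K x -> ~ interior K x ->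
          (fun k => F (xs k)) @ \oo --> +oo),
      (forall x h : V, interior K x ->
          `|D3 F x h| <= 2 * powR (D2 F x h) (3 / 2))
    & (forall (x : V) (tau : R), interior K x -> 0 < tau ->
          F (tau *: x) = F x - nu * ln tau)].

End LHSCB.

(* Main.v *)
(** Write [X] for Lambda(s_1) and [Y i] for Lambda(s_i), with [Y i0 := 0] at the
first index. The Schur complement factors as
[X - Y X^-1 Y = (X + Y) X^-1 (X - Y)], and it is positive definite together with
[X] iff [X + Y] and [X - Y] are. Hence the cone is cut out by linear matrix
inequalities, and on its interior
[F = sum_i (- ln det (X + Y i) - ln det (X - Y i) + ln det X)], so that only
derivatives of [ln det] of a linear map are needed.

For a direction with images [H] of [X] and [G i] of [Y i], conjugating
[[X, Y], [Y, X]] to block diagonal form in two ways, [diag(X + Y, X - Y)] and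
[diag(X, S)], shows [D2 F = tr N^2] and [D3 F = - 2 tr N^3] for the symmetric
block arrow matrix [N] with first diagonal block [K = X^-1/2 H X^-1/2] and
further blocks [S_i^-1/2 S_i' S_i^-1/2] (diagonal) and
[S_i^-1/2 Z_i^T X^-1/2] (first row and column), [Z_i = G_i - H X^-1 Y_i].
Self-concordance is then [|tr N^3| <= (tr N^2)^(3/2)]. At a boundary point some
Schur determinant vanishes in the limit, while all of them are bounded by
[det X] because [ln det] is concave. *)

Require Import Defs.
From HB Require Import structures.
From mathcomp Require Import all_boot all_order all_algebra.
From mathcomp Require Import all_classical all_reals all_analysis.
From mathcomp Require Import ring lra.
From mathcomp Require mpoly.
Import (canonicals, coercions) mpoly.

Set Implicit Arguments.
Unset Strict Implicit.
Unset Printing Implicit Defensive.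

Import Order.TTheory GRing.Theory Num.Theory.
Import numFieldNormedType.Exports.
Local Open Scope classical_set_scope.
Local Open Scope ring_scope.

(** * Scalar and Frobenius inequalities, positive definite matrices *)

(** A quadratic in [r] that stays nonnegative has nonpositive discriminant. The hypothesis is linear
    in [t], so for a sum [t] it can be checked summand by summand. *)
Lemma sqr_le_of_quadratic (R : realFieldType) (t a b : R) :
  0 <= a -> (forall r, 2 * r * t <= r ^+ 2 * a + b) -> t ^+ 2 <= a * b.
Proof.
rewrite le_eqVlt => /orP[/eqP <-|a0] h.
  have [t0|t0] := eqVneq t 0; first by rewrite t0 expr0n mul0r.
  (* With [a = 0] and [t != 0] this [r] would give [b + 1 <= b]. *)
  have := h ((b + 1) / (2 * t)).
  by rewrite (_ : 2 * _ * t = b + 1); [lra | field].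
have := h (t / a); have -> : (t / a) ^+ 2 * a = t ^+ 2 / a by field; exact: lt0r_neq0.
have -> : 2 * (t / a) * t = 2 * (t ^+ 2 / a) by ring.
move=> h1; have {}h1 : t ^+ 2 / a <= b by lra.
by rewrite mulrC -ler_pdivrMr.
Qed.

Lemma sum_CauchySchwarz (R : realFieldType) (I : finType) (a b : I -> R) :
  (\sum_i a i * b i) ^+ 2 <= (\sum_i a i ^+ 2) * (\sum_i b i ^+ 2).
Proof.
apply: sqr_le_of_quadratic; first by apply: sumr_ge0 => i _; exact: sqr_ge0.
move=> r; rewrite !mulr_sumr -big_split; apply: ler_sum => i _ /=.
by have := sqr_ge0 (r * a i - b i); nra.
Qed.

(* The scalar shadow of [|tr N^3| <= (tr N^2)^(3/2)] for the arrow matrix [N]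
   with diagonal [m] and [q] in row and column [i0]. *)
Lemma arrow_cubic_le (R : realFieldType) (I : finType) (i0 : I) (k : R)
    (m q : I -> R) : m i0 = k -> q i0 = 0 ->
  (\sum_i (m i ^+ 3 + 3 * (m i + k) * q i ^+ 2)) ^+ 2
    <= (\sum_i (m i ^+ 2 + 2 * q i ^+ 2)) ^+ 3.
Proof.
move=> mi0 qi0.
pose s := \sum_(i | i != i0) q i ^+ 2; pose mu := \sum_(i | i != i0) m i ^+ 2.
have s0 : 0 <= s by apply: sumr_ge0 => i _; exact: sqr_ge0.
have mu0 : 0 <= mu by apply: sumr_ge0 => i _; exact: sqr_ge0.
have qs i : i != i0 -> q i ^+ 2 <= s.
  by move=> ii; rewrite /s (bigD1 i)//= lerDl; apply: sumr_ge0 => j _; exact: sqr_ge0.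
have mmu i : i != i0 -> m i ^+ 2 <= mu.
  by move=> ii; rewrite /mu (bigD1 i)//= lerDl; apply: sumr_ge0 => j _; exact: sqr_ge0.
have -> : \sum_i (m i ^+ 2 + 2 * q i ^+ 2) = k ^+ 2 + 2 * s + mu.
  by rewrite (bigD1 i0)//= big_split /= -mulr_sumr mi0 qi0 -/s -/mu; ring.
(* The trace of [N^3] as the pairing of [N] with [N^2]: [k] meets [k^2 + s], [m i] meets
   [m i^2 + q i^2], and [q i] meets [q i * (m i + k)] twice. *)
have -> : \sum_i (m i ^+ 3 + 3 * (m i + k) * q i ^+ 2) =
    k * (k ^+ 2 + s) +
    \sum_(i | i != i0) (m i ^+ 3 + m i * q i ^+ 2 + 2 * q i ^+ 2 * (m i + k)).
  rewrite (bigD1 i0)//= mi0 qi0 [k * (_ + s)]mulrDr [k * s]mulr_sumr -[RHS]addrA -big_split /=.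
  by congr (_ + _); [ring | apply: eq_bigr => i _; ring].
(* With [a = tr N^2] and [b = (tr N^2)^2], the bound comes from expanding the squares of the entries
   of [r N - N^2] on the support of [N]. *)
rewrite [X in _ <= X]exprS; apply: sqr_le_of_quadratic; first by nra.
move=> r; rewrite mulrDr mulr_sumr.
have h : \sum_(i | i != i0)
    2 * r * (m i ^+ 3 + m i * q i ^+ 2 + 2 * q i ^+ 2 * (m i + k)) <=
    \sum_(i | i != i0) (m i ^+ 2 * (r ^+ 2 + mu + 4 * s + 2 * k ^+ 2)
                        + q i ^+ 2 * (2 * r ^+ 2 + 3 * s + 2 * k ^+ 2)).
  apply: ler_sum => i ii; have := qs _ ii; have := mmu _ ii.
  move: (m i) (q i) => x y xm ys.
  have h1 := sqr_ge0 (r * x - (x ^+ 2 + y ^+ 2)).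
  have h2 := sqr_ge0 (r * y - y * (x + k)).
  (* Absorbs the cross term [4 * k * x * y^2] left by twice [h2]. *)
  have h3 := sqr_ge0 (k * x - y ^+ 2).
  have h4 : x ^+ 2 * x ^+ 2 <= x ^+ 2 * mu by rewrite ler_wpM2l ?sqr_ge0.
  have h5 : x ^+ 2 * y ^+ 2 <= x ^+ 2 * s by rewrite ler_wpM2l ?sqr_ge0.
  have h6 : y ^+ 2 * y ^+ 2 <= y ^+ 2 * s by rewrite ler_wpM2l ?sqr_ge0.
  by lra.
rewrite big_split -!mulr_suml -/s -/mu /= in h.
by have := sqr_ge0 (r * k - (k ^+ 2 + s)); lra.
Qed.

(** * Frobenius norms and trace bounds *)

Section Frobenius.
Variable R : realFieldType.

Definition fro m n (A : 'M[R]_(m, n)) : R := \sum_i \sum_j A i j ^+ 2.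

Lemma fro_ge0 m n (A : 'M[R]_(m, n)) : 0 <= fro A.
Proof. by do 2 (apply: sumr_ge0 => ? _); exact: sqr_ge0. Qed.

Lemma fro_trmx m n (A : 'M[R]_(m, n)) : fro A^T = fro A.
Proof.
by rewrite /fro exchange_big /=; do 2 apply: eq_bigr => ? _; rewrite mxE.
Qed.

Lemma fro_trace m n (A : 'M[R]_(m, n)) : fro A = \tr (A *m A^T).
Proof.
by apply: eq_bigr => i _; rewrite mxE; apply: eq_bigr => j _; rewrite mxE expr2.
Qed.

Lemma sqr_mxtrace_mul_le m n (A : 'M[R]_(m, n)) (B : 'M[R]_(n, m)) :
  (\tr (A *m B)) ^+ 2 <= fro A * fro B.
Proof.
rewrite -[fro B]fro_trmx /fro !pair_big /=.
have -> : \tr (A *m B) = \sum_(x : 'I_m * 'I_n) A x.1 x.2 * B^T x.1 x.2.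
  rewrite -(pair_big xpredT xpredT (fun i j => A i j * B^T i j)) /=.
  by apply: eq_bigr => i _; rewrite mxE; apply: eq_bigr => j _; rewrite !mxE.
exact: sum_CauchySchwarz.
Qed.

Lemma fro_mul_le m n p (A : 'M[R]_(m, n)) (B : 'M[R]_(n, p)) :
  fro (A *m B) <= fro A * fro B.
Proof.
rewrite -[fro B]fro_trmx {2}/fro mulr_suml; apply: ler_sum => i _.
rewrite mulr_sumr; apply: ler_sum => j _; rewrite mxE.
apply: le_trans (sum_CauchySchwarz _ _) _; rewrite ler_wpM2l//.
  by apply: sumr_ge0 => ? _; exact: sqr_ge0.
by apply: ler_sum => k _; rewrite mxE.
Qed.

End Frobenius.

Section FrobeniusNorm.
Variable R : rcfType.

Definition nfro m n (A : 'M[R]_(m, n)) : R := Num.sqrt (fro A).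

Lemma nfro_ge0 m n (A : 'M[R]_(m, n)) : 0 <= nfro A.
Proof. exact: sqrtr_ge0. Qed.

Lemma sqr_nfro m n (A : 'M[R]_(m, n)) : nfro A ^+ 2 = fro A.
Proof. by rewrite sqr_sqrtr ?fro_ge0. Qed.

(** Cauchy-Schwarz splits off [C], and submultiplicativity separates [A] from [B]. *)
Lemma mxtrace3_le n p (A : 'M[R]_n) (B : 'M[R]_(n, p)) (C : 'M[R]_(p, n)) :
  `|\tr (A *m B *m C)| <= nfro A * nfro B * nfro C.
Proof.
rewrite -[leLHS]sqrtr_sqr /nfro -!sqrtrM ?mulr_ge0 ?fro_ge0// ler_wsqrtr//.
apply: le_trans (sqr_mxtrace_mul_le _ _) _.
by rewrite ler_wpM2r ?fro_ge0 ?fro_mul_le.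
Qed.

End FrobeniusNorm.

(** * Positive definite matrices, congruence and Cholesky factors *)

Section PositiveDefinite.
Variables (R : realFieldType) (L : nat).
Implicit Types A B : 'M[R]_L.

Definition possemidef A : Prop :=
  A^T = A /\ forall x : 'cV[R]_L, 0 <= (x^T *m A *m x) 0 0.

Lemma posdef_possemidef A : posdef A -> possemidef A.
Proof.
move=> [sA pA]; split=> // x; have [->|/pA/ltW//] := eqVneq x 0.
by rewrite mulmx0 mxE.
Qed.

Lemma possemidefZ (a : R) A : 0 <= a -> possemidef A -> possemidef (a *: A).
Proof.
move=> a0 [sA pA]; split=> [|x]; first by rewrite linearZ /= sA.
by rewrite -scalemxAr -scalemxAl mxE mulr_ge0.
Qed.

Lemma possemidefD A B : possemidef A -> possemidef B -> possemidef (A + B).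
Proof.
move=> [sA pA] [sB pB]; split=> [|x]; first by rewrite linearD /= sA sB.
by rewrite mulmxDr mulmxDl mxE addr_ge0.
Qed.

Lemma posdefZ (a : R) A : 0 < a -> posdef A -> posdef (a *: A).
Proof.
move=> a0 [sA pA]; split=> [|x x0]; first by rewrite linearZ /= sA.
by rewrite -scalemxAr -scalemxAl mxE mulr_gt0// pA.
Qed.

Lemma posdefZ_inv (a : R) A : 0 < a -> posdef (a *: A) -> posdef A.
Proof.
move=> a0 h; have := posdefZ (a := a^-1) _ h.
by rewrite scalerA mulVf ?gt_eqF// scale1r invr_gt0; exact.
Qed.

Lemma posdefDl A B : possemidef A -> posdef B -> posdef (A + B).
Proof.
move=> [sA pA] [sB pB]; split=> [|x x0]; first by rewrite linearD /= sA sB.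
by rewrite mulmxDr mulmxDl mxE ltr_wpDl// pB.
Qed.

Lemma posdefD A B : posdef A -> posdef B -> posdef (A + B).
Proof. by move=> /posdef_possemidef; exact: posdefDl. Qed.

Lemma posdef_conv (t : R) A B : 0 <= t <= 1 -> posdef A -> posdef B ->
  posdef (t *: A + (1 - t) *: B).
Proof.
move=> /andP[t0 t1] pA pB; have [->|tn1] := eqVneq t 1.
  by rewrite subrr scale0r addr0 scale1r.
apply: posdefDl; first exact/possemidefZ/posdef_possemidef.
by apply: posdefZ; rewrite // subr_gt0 lt_neqAle tn1.
Qed.

Lemma posdef_unitmx A : posdef A -> A \in unitmx.
Proof.
move=> [sA pA]; rewrite -row_free_unit -kermx_eq0; apply/rowV0P => v /sub_kermxP vA.
apply/eqP; rewrite -[v]trmxK trmx_eq0; apply: contraT => /pA.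
by rewrite trmxK vA mul0mx mxE ltxx.
Qed.

Lemma possemidef_congr A B : possemidef A -> possemidef (B^T *m A *m B).
Proof.
move=> [sA pA]; split=> [|x]; first by rewrite !trmx_mul trmxK sA mulmxA.
by have := pA (B *m x); rewrite trmx_mul !mulmxA.
Qed.

Lemma posdef_congr A B : B \in unitmx -> posdef A -> posdef (B^T *m A *m B).
Proof.
move=> uB [sA pA]; split=> [|x x0]; first by rewrite !trmx_mul trmxK sA mulmxA.
have Bx0 : B *m x != 0.
  by apply: contra x0 => /eqP h; rewrite -(mulKmx uB x) h mulmx0.
by have := pA _ Bx0; rewrite trmx_mul !mulmxA.
Qed.

Lemma posdef_gram n (B : 'M[R]_(n, L)) :
  (forall x : 'cV[R]_L, B *m x = 0 -> x = 0) -> posdef (B^T *m B).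
Proof.
move=> injB; split=> [|x x0]; first by rewrite trmx_mul trmxK.
rewrite mulmxA -trmx_mul -mulmxA mxE; set y := B *m x.
have y0 : y != 0 by apply: contra x0 => /eqP /injB ->.
have [i yi] : exists i, y i 0 != 0.
  apply/existsP; apply: contraT => /existsPn h; case/eqP: y0.
  by apply/colP => i; rewrite [RHS]mxE; apply/eqP; have := h i; rewrite negbK.
rewrite (bigD1 i)//= mxE -expr2 ltr_pwDl//.
  by rewrite exprn_even_gt0.
by apply: sumr_ge0 => j _; rewrite mxE -expr2 sqr_ge0.
Qed.

End PositiveDefinite.

Section Cholesky.
Variable R : rcfType.

(** Induction on the size: the Schur complement [S] of the first pivot is again positive definite,
    and its factor completes a block upper triangular [C]. *)
Lemma cholesky L (A : 'M[R]_L) :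
  posdef A -> exists2 C : 'M[R]_L, C \in unitmx & A = C^T *m C.
Proof.
elim: L A => [|n IH] A pA.
  by exists 1%:M; rewrite ?unitmx1//; apply/matrixP => -[].
rewrite -[n.+1]/(1 + n)%N in A pA *.
set a := A 0 0; pose b : 'rV[R]_n := ursubmx A; pose D : 'M[R]_n := drsubmx A.
have sA := pA.1; have qA := pA.2.
have a0 : 0 < a.
  have e0 : delta_mx 0 0 != 0 :> 'cV[R]_(1 + n).
    by apply/eqP => /matrixP/(_ 0 0)/eqP; rewrite !mxE eqxx oner_eq0.
  have := qA _ e0; rewrite trmx_delta -rowE -colE !mxE.
  by [].
have EA : A = block_mx a%:M b b^T D.
  rewrite -[LHS]submxK; congr block_mx.
    by apply/matrixP => i j; rewrite !ord1 !mxE /= /a; congr (A _ _); exact: val_inj.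
  by rewrite trmx_ursub sA.
have sD : D^T = D by rewrite trmx_drsub sA.
pose S := D - a^-1 *: (b^T *m b).
have pS : posdef S.
  split; first by rewrite linearB linearZ /= trmx_mul trmxK sD.
  move=> x x0.
  (* The first coordinate is chosen so that [A *m y] starts with [0]; the form of [A] at [y] is then
     that of [S] at [x]. *)
  pose y : 'cV[R]_(1 + n) := col_mx (- a^-1 *: (b *m x)) x.
  have y0 : y != 0.
    by apply: contra x0 => /eqP/(congr1 dsubmx); rewrite col_mxKd linear0 => ->.
  have Ay : A *m y = col_mx 0 (S *m x).
    rewrite EA mul_block_col; congr col_mx.
      by rewrite mul_scalar_mx scalerA mulrN divff ?gt_eqF// scaleN1r addNr.
    by rewrite mulmxBl -scalemxAl -scalemxAr scaleNr mulmxA addrC.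
  by have := qA _ y0; rewrite -mulmxA Ay tr_col_mx mul_row_col mulmx0 add0r mulmxA.
have [C' uC' EC'] := IH _ pS.
pose C : 'M[R]_(1 + n) := block_mx (Num.sqrt a)%:M ((Num.sqrt a)^-1 *: b) 0 C'.
have sa0 : Num.sqrt a != 0 by rewrite gt_eqF// sqrtr_gt0.
exists C.
  rewrite unitmxE det_ublock unitrM -!unitmxE uC' andbT unitmxE det_scalar1.
  by rewrite unitfE.
rewrite EA /C tr_block_mx mulmx_block trmx0 !tr_scalar_mx !mul0mx !mulmx0 !addr0 -EC'.
congr block_mx.
- by rewrite -scalar_mxM -expr2 sqr_sqrtr// ltW.
- by rewrite mul_scalar_mx scalerA divff// scale1r.
- by rewrite linearZ /= mul_mx_scalar scalerA divff// scale1r.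
- rewrite [(_ *: b)^T]linearZ /= -scalemxAl -scalemxAr scalerA -invfM -expr2 sqr_sqrtr 1?ltW//.
  by rewrite /S addrC subrK.
Qed.

End Cholesky.

(** * Schur complements and trace identities *)

Ltac mxexpand := rewrite ?(mulmxDl, mulmxDr, mulmxBl, mulmxBr, mulNmx, mulmxN,
  mulmx1, mul1mx, mulmxA).

(* Closes identities that hold in the additive group of matrices, products
   being treated as atoms. *)
Ltac mxabel :=
  repeat match goal with |- context [mulmx ?A ?B] =>
    let z := fresh "z" in set z := (mulmx A B); clearbody z end;
  apply/matrixP => ? ?; rewrite !mxE; ring.

Section Schur.
Variables (R : realFieldType) (L : nat) (X Y : 'M[R]_L).
Hypotheses (uX : X \in unitmx) (sX : X^T = X) (sY : Y^T = Y).

Definition schurc : 'M[R]_L := X - Y *m invmx X *m Y.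
Local Notation W := (invmx X *m Y).

Let mulXW : X *m W = Y. Proof. by rewrite mulmxA mulmxV// mul1mx. Qed.

Let trW : W^T = Y *m invmx X.
Proof. by rewrite trmx_mul trmx_inv sX sY. Qed.

Lemma schurc_addl : (X + Y) *m (1%:M - W) = schurc.
Proof. by rewrite mulmxBr mulmx1 mulmxDl mulXW /schurc; mxexpand; mxabel. Qed.

Lemma schurcE : schurc = (X + Y) *m invmx X *m (X - Y).
Proof. by mxexpand; rewrite mulmxV// mulmxKV// !mul1mx /schurc; mxabel. Qed.

(** [(X + Y) *m (1%:M - W)] and [(X - Y) *m (1%:M + W)] both equal the Schur complement, so the
    terms in [W^T] cancel. Positivity of [X + Y] and [X - Y] thus passes to the Schur complement by
    congruence. *)
Lemma schurc_sum :
  2 *: schurc = (1%:M - W)^T *m (X + Y) *m (1%:M - W)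
              + (1%:M + W)^T *m (X - Y) *m (1%:M + W).
Proof.
rewrite [(_ - _)^T]linearB [(_ + _)^T]linearD /= !trmx1 trW /schurc.
by mxexpand; rewrite ?mulmxKV// ?mulmxK// ?mulmxV// ?mul1mx ?mulmx1; mxabel.
Qed.

(** Gives the converse passage: a congruence of [X] plus the Schur complement. *)
Lemma addmx_schurc : 2 *: (X + Y) = (1%:M + W)^T *m X *m (1%:M + W) + schurc.
Proof.
rewrite [(_ + _)^T]linearD /= trmx1 trW /schurc.
by mxexpand; rewrite ?mulmxKV// ?mulmxK// ?mulmxV// ?mul1mx ?mulmx1; mxabel.
Qed.

Lemma posdef_addmx_schurc : posdef X -> posdef schurc -> posdef (X + Y).
Proof.
move=> pX pS; apply: (@posdefZ_inv _ _ 2) => //; rewrite addmx_schurc.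
by apply: posdefDl => //; apply/possemidef_congr/posdef_possemidef.
Qed.

Lemma posdef_schurc : posdef (X + Y) -> posdef (X - Y) -> posdef schurc.
Proof.
move=> pP pN; apply: (@posdefZ_inv _ _ 2) => //; rewrite schurc_sum.
have E : (1%:M - W) = invmx X *m (X - Y) by mxexpand; rewrite mulVmx.
apply: posdefD; apply: posdef_congr => //.
  by rewrite E unitmx_mul unitmx_inv uX posdef_unitmx.
have -> : (1%:M + W) = invmx X *m (X + Y) by mxexpand; rewrite mulVmx.
by rewrite unitmx_mul unitmx_inv uX posdef_unitmx.
Qed.

End Schur.

Lemma schurcN (R : realFieldType) L (X Y : 'M[R]_L) : schurc X (- Y) = schurc X Y.
Proof. by rewrite /schurc !mulNmx mulmxN opprK. Qed.

Lemma posdef_submx_schurc (R : realFieldType) L (X Y : 'M[R]_L) :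
  X^T = X -> Y^T = Y -> posdef X -> posdef (schurc X Y) -> posdef (X - Y).
Proof.
move=> sX sY pX pS; apply: posdef_addmx_schurc; rewrite ?schurcN ?linearN/= ?sY//.
exact: posdef_unitmx.
Qed.

Lemma det_schurc (R : realFieldType) L (X Y : 'M[R]_L) : X \in unitmx ->
  \det (schurc X Y) = \det (X + Y) * \det (X - Y) / \det X.
Proof. by move=> uX; rewrite schurcE// !det_mulmx det_inv mulrAC. Qed.

(** * Traces of powers under the two block diagonalizations *)

Section SimilarTraces.
Variables (R : comUnitRingType) (n : nat) (Q M V V' : 'M[R]_n).
Hypotheses (V'V : V' *m V = 1%:M) (QV : Q *m V = V *m M).

Lemma mxtrace_similar2 : \tr (Q *m Q) = \tr (M *m M).
Proof.
rewrite -[Q *m Q]mulmx1 -(mulmx1C V'V) mulmxA -(mulmxA Q Q) QV mulmxA QV.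
by rewrite mxtrace_mulC !mulmxA V'V mul1mx.
Qed.

Lemma mxtrace_similar3 : \tr (Q *m Q *m Q) = \tr (M *m M *m M).
Proof.
rewrite -[Q *m Q *m Q]mulmx1 -(mulmx1C V'V) mulmxA -2!(mulmxA Q) -(mulmxA Q Q) QV.
rewrite (mulmxA Q V) QV !mulmxA QV.
by rewrite mxtrace_mulC !mulmxA V'V mul1mx.
Qed.

End SimilarTraces.

Section TraceIdentities.
Variables (R : realFieldType) (L : nat).

(** At [A] in direction [B], the second derivative of [ln det] is [- tr2 A B] and the third is
    [2 * tr3 A B]. *)
Definition tr2 (A B : 'M[R]_L) : R := \tr (invmx A *m B *m (invmx A *m B)).
Definition tr3 (A B : 'M[R]_L) : R :=
  \tr (invmx A *m B *m (invmx A *m B) *m (invmx A *m B)).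

Variables (X Y H G : 'M[R]_L).
Hypotheses (uX : X \in unitmx) (sX : X^T = X) (sY : Y^T = Y).
Hypotheses (uP : X + Y \in unitmx) (uN : X - Y \in unitmx) (uS : schurc X Y \in unitmx).

Local Notation W := (invmx X *m Y).
Local Notation Wt := (Y *m invmx X).
Local Notation S := (schurc X Y).

(** The blocks of [[[H, G], [G, H]]] after the elimination that brings [[[X, Y], [Y, X]]] to
    [diag(X, S)]. [schur_deriv] is also the derivative of the Schur complement in direction
    [(H, G)]. *)
Definition schur_offdiag := G - H *m W.
Definition schur_offdiagt := G - Wt *m H.
Definition schur_deriv := H - G *m W - Wt *m G + Wt *m H *m W.
Local Notation Z := schur_offdiag.
Local Notation Zt := schur_offdiagt.
Local Notation S' := schur_deriv.

(** [V] is the product of [[[1, 1], [1, -1]]], which leads to [diag(X + Y, X - Y)], and the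
    elimination matrix [[[1, -W], [0, 1]]]; it conjugates [Qmx] into [Rmx]. *)
Local Notation Rmx := (block_mx (invmx X *m H) (invmx X *m Z) (invmx S *m Zt) (invmx S *m S')).
Local Notation Qmx := (block_mx (invmx (X + Y) *m (H + G)) 0 0 (invmx (X - Y) *m (H - G))).
Local Notation V := (block_mx 1%:M (1%:M - W) 1%:M (- (1%:M + W))).
Local Notation V' := (2^-1 *: block_mx (1%:M + W) (1%:M - W) 1%:M (- 1%:M)).

Let V'V : V' *m V = 1%:M.
Proof.
rewrite -scalemxAl mulmx_block scale_block_mx scalar_mx_block.
by congr block_mx; mxexpand; apply/matrixP => i j; rewrite !mxE; field.
Qed.

Let mulNS : (1%:M + W) *m invmx S = invmx (X - Y).
Proof.
have h : (X - Y) *m (1%:M + W) = S.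
  by rewrite -schurcN -(@schurc_addl _ _ X (- Y))// mulmxN opprK.
by rewrite -(mulKmx uN (1%:M + W)) h mulmxK.
Qed.

Let mulPS : (1%:M - W) *m invmx S = invmx (X + Y).
Proof. by rewrite -(mulKmx uP (1%:M - W)) schurc_addl// mulmxK. Qed.

Let QV : Qmx *m V = V *m Rmx.
Proof.
have e1 : invmx X = invmx (X + Y) *m (1%:M + Wt).
  by rewrite -[LHS](mulKmx uP) mulmxDl mulmxV.
have e2 : invmx X = invmx (X - Y) *m (1%:M - Wt).
  by rewrite -[LHS](mulKmx uN) mulmxBl mulmxV.
rewrite !mulmx_block !mul0mx !mul1mx !mulNmx !mulmx1 addr0 add0r !addr0 ?add0r.
rewrite !(mulmxA _ (invmx S)) mulPS mulNS.
congr block_mx.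
- by rewrite [in RHS]e1 -!mulmxA -mulmxDr; congr (_ *m _); rewrite /Zt; mxexpand; mxabel.
- rewrite [in RHS]e1 -!mulmxA -mulmxDr; congr (_ *m _).
  by rewrite /Z /S'; mxexpand; mxabel.
- by rewrite [in RHS]e2 -!mulmxA -mulmxBr; congr (_ *m _); rewrite /Zt; mxexpand; mxabel.
- rewrite [in RHS]e2 -!mulmxA -mulmxBr -mulmxN; congr (_ *m _).
  by rewrite /Z /S'; mxexpand; mxabel.
Qed.

Lemma tr2_schurc : tr2 (X + Y) (H + G) + tr2 (X - Y) (H - G) - tr2 X H =
  tr2 S S' + 2 * \tr (invmx X *m Z *m (invmx S *m Zt)).
Proof.
have := mxtrace_similar2 V'V QV.
rewrite !mulmx_block !mxtrace_block !mul0mx addr0 add0r !mxtraceD.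
rewrite -![\tr (_ *m _)]/(tr2 _ _) => ->.
rewrite (mxtrace_mulC (invmx S *m Zt)) /tr2; ring.
Qed.

Lemma tr3_schurc : tr3 (X + Y) (H + G) + tr3 (X - Y) (H - G) - tr3 X H =
  tr3 S S' + 3 * \tr (invmx X *m H *m (invmx X *m Z *m (invmx S *m Zt)))
           + 3 * \tr (invmx S *m S' *m (invmx S *m Zt *m (invmx X *m Z))).
Proof.
have := mxtrace_similar3 V'V QV.
rewrite !mulmx_block !mxtrace_block ?(mul0mx, mulmx0, addr0, add0r).
rewrite /tr3 => ->.
move: (invmx X *m H) (invmx X *m Z) (invmx S *m Zt) (invmx S *m S') => a b c d.
rewrite !mulmxDl !mxtraceD.
(* The mixed words of the cube form two classes of three cyclic rotations, hence the factors [3]. *)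
have cyc (u v w : 'M[R]_L) : \tr (u *m v *m w) = \tr (w *m u *m v).
  by rewrite mxtrace_mulC mulmxA.
rewrite (cyc c a b) (cyc b c a) (cyc b d c) (cyc c b d) !mulmxA.
ring.
Qed.

End TraceIdentities.

(** * Rescaling by Cholesky factors and the cubic bound *)

Section ScaledTraces.
Variables (R : rcfType) (L : nat).
Implicit Types X H : 'M[R]_L.

Lemma invmx_gram (C : 'M[R]_L) : C \in unitmx ->
  invmx (C^T *m C) = invmx C *m (invmx C)^T.
Proof.
move=> uC; have uCC : C^T *m C \in unitmx by rewrite unitmx_mul unitmx_tr uC.
rewrite -[RHS](mulKmx uCC) -!mulmxA (mulmxA C) mulmxV// mul1mx -trmx_mul mulVmx//.
by rewrite trmx1 mulmx1.
Qed.

Lemma tr2_gram (C : 'M[R]_L) H : C \in unitmx -> H^T = H ->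
  tr2 (C^T *m C) H = fro ((invmx C)^T *m H *m invmx C).
Proof.
move=> uC sH; rewrite fro_trace !trmx_mul trmxK sH /tr2 invmx_gram//.
by rewrite -!mulmxA mxtrace_mulC -!mulmxA.
Qed.

Lemma tr2_ge0 X H : posdef X -> H^T = H -> 0 <= tr2 X H.
Proof.
by move=> pX sH; have [C uC ->] := cholesky pX; rewrite tr2_gram// fro_ge0.
Qed.

(* With Cholesky factors of [X] and [S] the traces become Frobenius norms of
   the rescaled blocks. *)
Lemma schur_terms_bound X Y H G (C : 'M[R]_L) :
    C \in unitmx -> X = C^T *m C -> Y^T = Y -> H^T = H -> G^T = G ->
    posdef (X + Y) -> posdef (X - Y) ->
  exists m q : R, [/\ 0 <= m, 0 <= q,
    tr2 (X + Y) (H + G) + tr2 (X - Y) (H - G) - tr2 X H = m ^+ 2 + 2 * q ^+ 2 &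
    `|tr3 (X + Y) (H + G) + tr3 (X - Y) (H - G) - tr3 X H| <=
      m ^+ 3 + 3 * (m + nfro ((invmx C)^T *m H *m invmx C)) * q ^+ 2].
Proof.
move=> uC XC sY sH sG pP pN.
have sX : X^T = X by rewrite XC trmx_mul trmxK.
have uX : X \in unitmx by rewrite XC unitmx_mul unitmx_tr uC.
have pS := posdef_schurc uX sX sY pP pN.
have [D uD SD] := cholesky pS.
have uS := posdef_unitmx pS.
have uP := posdef_unitmx pP; have uN := posdef_unitmx pN.
rewrite tr2_schurc ?tr3_schurc//.
set Z := schur_offdiag _ _ _ _; set S' := schur_deriv _ _ _ _.
have -> : schur_offdiagt X Y H G = Z^T.
  by rewrite /Z /schur_offdiag linearB /= !trmx_mul trmx_inv sX sY sH sG.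
have sS' : S'^T = S'.
  have trD (A B : 'M[R]_L) : (A + B)^T = A^T + B^T by exact: linearD.
  have trB (A B : 'M[R]_L) : (A - B)^T = A^T - B^T by exact: linearB.
  rewrite /S' /schur_deriv trD !trB !trmx_mul trmx_inv sX sY sH sG.
  by rewrite !mulmxA; congr (_ + _); rewrite addrAC.
(* The rescaled arrow blocks: [K] in the corner, [M] on the diagonal, [Q] off the diagonal. *)
pose K := (invmx C)^T *m H *m invmx C.
pose M := (invmx D)^T *m S' *m invmx D.
pose Q := (invmx D)^T *m Z^T *m invmx C.
have sM : M^T = M by rewrite /M !trmx_mul trmxK sS' mulmxA.
exists (nfro M), (nfro Q); split; [exact: nfro_ge0|exact: nfro_ge0| |].
  rewrite /tr2 !sqr_nfro !fro_trace sM SD XC !invmx_gram//; congr (_ + 2 * _).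
    by rewrite /M -!mulmxA mxtrace_mulC -!mulmxA.
  rewrite /Q !trmx_mul !trmxK -!mulmxA [in RHS]mxtrace_mulC -!mulmxA.
  rewrite [in RHS]mxtrace_mulC -!mulmxA.
  by [].
have nQt : nfro Q^T = nfro Q by rewrite /nfro fro_trmx.
have -> : tr3 (schurc X Y) S' = \tr (M *m M *m M).
  by rewrite /tr3 SD invmx_gram// /M -!mulmxA mxtrace_mulC -!mulmxA.
have -> : \tr (invmx X *m H *m (invmx X *m Z *m (invmx (schurc X Y) *m Z^T)))
    = \tr (K *m Q^T *m Q).
  rewrite SD XC !invmx_gram// /K /Q !trmx_mul !trmxK -!mulmxA mxtrace_mulC.
  by rewrite -!mulmxA.
have -> : \tr (invmx (schurc X Y) *m S' *m
      (invmx (schurc X Y) *m Z^T *m (invmx X *m Z))) = \tr (M *m Q *m Q^T).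
  rewrite SD XC !invmx_gram// /M /Q !trmx_mul !trmxK -!mulmxA mxtrace_mulC.
  by rewrite -!mulmxA.
have := mxtrace3_le M M M; have := mxtrace3_le K Q^T Q.
have := mxtrace3_le M Q Q^T; rewrite nQt -/K.
move: (\tr _) (\tr _) (\tr _) => a b c; rewrite !ler_norml => ? ? ?.
lra.
Qed.

(* [i0] is the index of the block without off-diagonal part; it carries the
   single term [tr2 X H]. *)
Lemma barrier_cubic_le (I : finType) (i0 : I) X H (Y G : I -> 'M[R]_L) :
    posdef X -> H^T = H -> (forall i, (Y i)^T = Y i) -> (forall i, (G i)^T = G i) ->
    Y i0 = 0 -> G i0 = 0 ->
    (forall i, posdef (X + Y i)) -> (forall i, posdef (X - Y i)) ->
  let e2 i := tr2 (X + Y i) (H + G i) + tr2 (X - Y i) (H - G i) - tr2 X H in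
  let e3 i := tr3 (X + Y i) (H + G i) + tr3 (X - Y i) (H - G i) - tr3 X H in
  0 <= \sum_i e2 i /\ (\sum_i e3 i) ^+ 2 <= (\sum_i e2 i) ^+ 3.
Proof.
move=> pX sH sY sG Y0 G0 pP pN e2 e3.
have [C uC XC] := cholesky pX.
set k := nfro ((invmx C)^T *m H *m invmx C).
(* At [i0] the three terms collapse to [tr2 X H], so this index carries the corner of the arrow, the
   pair [(k, 0)]. *)
have /fin_all_exists[mq hmq] i : exists mq : R * R, [/\ i = i0 -> mq = (k, 0),
    0 <= mq.1, e2 i = mq.1 ^+ 2 + 2 * mq.2 ^+ 2 &
    `|e3 i| <= mq.1 ^+ 3 + 3 * (mq.1 + k) * mq.2 ^+ 2].
  have [->|ii0] := eqVneq i i0.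
    exists (k, 0); split; [by []|exact: nfro_ge0| |] => /=;
      rewrite /e2 /e3 Y0 G0 !addr0 !subr0 addrK expr0n mulr0 addr0.
      by rewrite sqr_nfro XC tr2_gram.
    set K := (invmx C)^T *m H *m invmx C in k *.
    have -> : tr3 X H = \tr (K *m K *m K).
      by rewrite /tr3 XC invmx_gram// /K -!mulmxA mxtrace_mulC -!mulmxA.
    by apply: le_trans (mxtrace3_le K K K) _; rewrite -expr2 -exprSr.
  have [m [q [m0 q0 h2 h3]]] := schur_terms_bound uC XC (sY i) sH (sG i) (pP i) (pN i).
  by exists (m, q); split; [move/eqP; rewrite (negbTE ii0) | exact: m0 | exact: h2 | exact: h3].
have [E0 _ _ _] := hmq i0.
have E2 : \sum_i e2 i = \sum_i ((mq i).1 ^+ 2 + 2 * (mq i).2 ^+ 2).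
  by apply: eq_bigr => i _; case: (hmq i).
rewrite E2; split.
  by apply: sumr_ge0 => i _; rewrite addr_ge0 ?sqr_ge0// mulr_ge0 ?sqr_ge0.
apply: (le_trans _ (arrow_cubic_le (i0 := i0) (k := k) _ _)); rewrite ?E0//.
rewrite -[leLHS]real_normK ?num_real// ler_sqr ?nnegrE//.
  by apply: le_trans (ler_norm_sum _ _ _) _; apply: ler_sum => i _; case: (hmq i).
apply: sumr_ge0 => i _; have [_ m0 _ _] := hmq i.
rewrite addr_ge0 ?exprn_ge0// mulr_ge0 ?sqr_ge0// mulr_ge0//.
by rewrite addr_ge0 ?nfro_ge0.
Qed.

End ScaledTraces.

(** * Entrywise limits and directional derivatives *)

Section EntrywiseConvergence.
Variables (R : realType) (T : Type) (F : set_system T).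
Context {FF : Filter F}.

(** Stated for a general filter, to serve both neighbourhoods and the punctured ones of difference
    quotients. *)
Definition mxcvg p q (f : T -> 'M[R]_(p, q)) (M : 'M[R]_(p, q)) : Prop :=
  forall i j, f x i j @[x --> F] --> M i j.

Lemma cvg_sum (I : Type) (r : seq I) (P : pred I) (f : I -> T -> R) (l : I -> R) :
  (forall i, P i -> f i x @[x --> F] --> l i) ->
  \sum_(i <- r | P i) f i x @[x --> F] --> \sum_(i <- r | P i) l i.
Proof. by move=> h; apply: cvg_big => //; exact: add_continuous. Qed.

Lemma cvg_prod (I : Type) (r : seq I) (P : pred I) (f : I -> T -> R) (l : I -> R) :
  (forall i, P i -> f i x @[x --> F] --> l i) ->
  \prod_(i <- r | P i) f i x @[x --> F] --> \prod_(i <- r | P i) l i.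
Proof. by move=> h; apply: cvg_big => //; exact: mul_continuous. Qed.

Lemma mxcvg_cst p q (M : 'M[R]_(p, q)) : mxcvg (fun=> M) M.
Proof. by move=> i j; exact: cvg_cst. Qed.

Lemma mxcvgM p q r (f : T -> 'M[R]_(p, q)) (g : T -> 'M[R]_(q, r)) M N :
  mxcvg f M -> mxcvg g N -> mxcvg (fun x => f x *m g x) (M *m N).
Proof.
move=> fM gN i j; rewrite mxE; under eq_fun do rewrite mxE.
by apply: cvg_sum => k _; apply: cvgM; [exact: fM|exact: gN].
Qed.

Lemma mxcvgD p q (f g : T -> 'M[R]_(p, q)) M N :
  mxcvg f M -> mxcvg g N -> mxcvg (fun x => f x + g x) (M + N).
Proof.
move=> fM gN i j; rewrite mxE; under eq_fun do rewrite mxE.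
by apply: cvgD; [exact: fM|exact: gN].
Qed.

Lemma mxcvgZ p q (a : R) (f : T -> 'M[R]_(p, q)) M :
  mxcvg f M -> mxcvg (fun x => a *: f x) (a *: M).
Proof.
move=> fM i j; rewrite mxE; under eq_fun do rewrite mxE.
by apply: cvgM; [exact: cvg_cst|exact: fM].
Qed.

Lemma mxcvg_trace n (f : T -> 'M[R]_n) M :
  mxcvg f M -> \tr (f x) @[x --> F] --> \tr M.
Proof. by move=> fM; apply: cvg_sum => i _; exact: fM. Qed.

Lemma mxcvg_fro p q (f : T -> 'M[R]_(p, q)) M :
  mxcvg f M -> fro (f x) @[x --> F] --> fro M.
Proof.
move=> fM; apply: cvg_sum => i _; apply: cvg_sum => j _.
by under eq_fun do rewrite expr2; rewrite expr2; apply: cvgM; exact: fM.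
Qed.

Lemma mxcvg_det n (f : T -> 'M[R]_n) M :
  mxcvg f M -> \det (f x) @[x --> F] --> \det M.
Proof.
move=> fM; apply: cvg_sum => s _; apply: cvgM; first exact: cvg_cst.
by apply: cvg_prod => i _; exact: fM.
Qed.

Lemma mxcvg_unit n (f : T -> 'M[R]_n) M :
  mxcvg f M -> M \in unitmx -> \forall x \near F, f x \in unitmx.
Proof.
move=> fM uM; have := mxcvg_det fM; rewrite unitmxE unitfE in uM.
move/cvgr_neq0 => /(_ uM); apply: filterS => x.
by rewrite unitmxE unitfE.
Qed.

Lemma mxcvg_inv n (f : T -> 'M[R]_n) M :
  mxcvg f M -> M \in unitmx -> mxcvg (fun x => invmx (f x)) (invmx M).
Proof.
move=> fM uM i j.
(* Cramer's formula. It holds for invertible [N] only, since [invmx] leaves singular matrices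
   unchanged; the limit is therefore taken along an eventually equal function. *)
have E N : N \in unitmx -> invmx N i j =
    (\det N)^-1 * ((-1) ^+ (j + i) * \det (row' j (col' i N))).
  by move=> uN; rewrite /invmx uN !mxE.
rewrite E//; apply: cvg_trans.
  apply: (@near_eq_cvg _ _ _ _ (fun x => (\det (f x))^-1 *
     ((-1) ^+ (j + i) * \det (row' j (col' i (f x)))))).
  by have := mxcvg_unit fM uM; apply: filterS => x ux; rewrite E.
apply: cvgM; first by apply: cvgV; [rewrite -unitfE -unitmxE|exact: mxcvg_det].
apply: cvgM; first exact: cvg_cst.
apply: mxcvg_det => k l; rewrite !mxE.
by under eq_fun do rewrite !mxE; exact: fM.
Qed.

End EntrywiseConvergence.

(** * Directional derivatives of scalar and matrix functions *)

Section DirectionalDerivative.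
Variables (R : realType) (V : normedModType R).
Implicit Types (f : V -> R) (x v : V).

Lemma is_derive_cvg f x v (d : R) :
  (h^-1 *: (f (h *: v + x) - f x) @[h --> 0^'] --> d) -> is_derive x v f d.
Proof. by move=> fd; apply: DeriveDef; [apply/cvg_ex; exists d|exact: cvg_lim]. Qed.

(** Both difference quotients are the same function of [h]; directional derivatives thus reduce to
    one real variable. *)
Lemma is_derive_line f x v (t d : R) :
  is_derive (t *: v + x) v f d <-> is_derive t 1 (fun s : R => f (s *: v + x)) d.
Proof.
have E : (fun h : R => h^-1 *: (f (h *: v + (t *: v + x)) - f (t *: v + x))) =
  (fun h : R => h^-1 *: ((fun s : R => f (s *: v + x)) (h *: (1 : R) + t) - f (t *: v + x))).
  by apply/funext => h /=; rewrite addrA -scalerDl [_%:A]mulr1.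
have Ed : derivable (fun s : R => f (s *: v + x)) t 1 = derivable f (t *: v + x) v.
  by rewrite /derivable E.
have ED : 'D_1 (fun s : R => f (s *: v + x)) t = 'D_v f (t *: v + x).
  by rewrite /derive E.
split=> -[h1 h2]; apply: DeriveDef.
- by rewrite Ed; exact: h1.
- by rewrite ED; exact: h2.
- by rewrite -Ed; exact: h1.
- by rewrite -ED; exact: h2.
Qed.

Lemma is_derive_bigsum n (h : 'I_n -> V -> R) x v (dh : 'I_n -> R) :
  (forall i, is_derive x v (h i) (dh i)) ->
  is_derive x v (fun y => \sum_(i < n) h i y) (\sum_(i < n) dh i).
Proof.
move=> hd; have -> : (fun y => \sum_(i < n) h i y) = \sum_(i < n) h i.
  by apply/funext => y; rewrite fct_sumE.
exact: is_derive_sum.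
Qed.

Definition mxder p q (f : V -> 'M[R]_(p, q)) x v (D : 'M[R]_(p, q)) : Prop :=
  forall i j, is_derive x v (fun y => f y i j) (D i j).

Lemma mxder_cst p q (M : 'M[R]_(p, q)) x v : mxder (fun=> M) x v 0.
Proof. by move=> i j; rewrite mxE; exact: is_derive_cst. Qed.

Lemma mxderM p q r (f : V -> 'M[R]_(p, q)) (g : V -> 'M[R]_(q, r)) x v D E :
  mxder f x v D -> mxder g x v E ->
  mxder (fun y => f y *m g y) x v (D *m g x + f x *m E).
Proof.
move=> fD gE i j; under [X in is_derive _ _ X _]eq_fun do rewrite mxE.
rewrite !mxE -big_split /=; apply: is_derive_bigsum => k.
apply: is_derive_eq; first by apply: is_deriveM; [exact: fD|exact: gE].
by rewrite /= addrC; congr (_ + _); rewrite /GRing.scale /= mulrC.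
Qed.

Lemma mxder_trace n (f : V -> 'M[R]_n) x v D :
  mxder f x v D -> is_derive x v (fun y => \tr (f y)) (\tr D).
Proof. by move=> fD; apply: is_derive_bigsum => i; exact: fD. Qed.

End DirectionalDerivative.

(** * Jacobi's formula through the characteristic polynomial *)

Lemma horner_char_poly (R : comNzRingType) n (A : 'M[R]_n) (a : R) :
  (char_poly A).[a] = \det (a%:M - A).
Proof.
rewrite horner_sum; apply: eq_bigr => s _.
rewrite hornerM horner_exp !hornerE; congr (_ * _).
rewrite (big_morph _ (fun p q => hornerM p q a) (hornerC 1 a)).
by apply: eq_bigr => i _; rewrite !mxE !(hornerE, hornerMn).
Qed.

(* The reversed characteristic polynomial of [- M]. *)
Definition det1_poly (R : comNzRingType) n (M : 'M[R]_n) : {poly R} :=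
  \poly_(j < n.+1) ((-1) ^+ j * (char_poly M)`_(n - j)).

(** For [t != 0] the determinant is [(- t)^n] times the characteristic polynomial at [- t^-1], which
    reverses the coefficients. *)
Lemma horner_det1_poly (R : fieldType) n (M : 'M[R]_n) (t : R) :
  (det1_poly M).[t] = \det (1%:M + t *: M).
Proof.
have lead : (char_poly M)`_n = 1.
  by have /eqP := char_poly_monic M; rewrite lead_coefE size_char_poly.
have [->|t0] := eqVneq t 0.
  rewrite scale0r addr0 det1 horner_coef0 coef_poly /=.
  by rewrite expr0 mul1r subn0 lead.
have -> : 1%:M + t *: M = (- t) *: ((- t^-1)%:M - M).
  rewrite scalerBr scaleNr [in RHS]scaleNr opprK; congr (_ + _).
  by rewrite -scaleNr scale_scalar_mx mulrNN divff.
rewrite detZ -horner_char_poly /det1_poly horner_poly horner_coef size_char_poly mulr_sumr.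
rewrite (reindex_inj rev_ord_inj) /=; apply: eq_bigr => -[i]/= ilt _.
rewrite subSS subKn//.
have -> : (- t) ^+ n = (- t) ^+ (n - i) * (- t) ^+ i by rewrite -exprD subnK.
rewrite mulrAC -exprMn mulN1r -mulrA; congr (_ * _).
by rewrite mulrCA -exprMn mulrNN divff// expr1n mulr1.
Qed.

(** The linear coefficient is minus the subleading coefficient of the characteristic polynomial.
    Size [0] has none and is treated apart. *)
Lemma deriv_det1_poly (R : comNzRingType) n (M : 'M[R]_n) :
  ((det1_poly M)^`()).[0] = \tr M.
Proof.
rewrite horner_coef0 coef_deriv mulr1n coef_poly ltnS.
case: n M => [|n] M; first by rewrite /mxtrace big_ord0.
by rewrite /= expr1 subn1 char_poly_trace// mulrNN mul1r.
Qed.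

Section LogDet.
Variables (R : realType) (V : normedModType R) (L : nat) (A : V -> 'M[R]_L).
Hypothesis linA : forall a x y, A (a *: x + y) = a *: A x + A y.

Let B x : 'M[R]_L := invmx (A x).

(** On the line through [x] along [v], [A] factors as [A x] times [1%:M + t *: M], which reduces the
    derivative to the one at the identity. *)
Lemma is_derive_lndet x v : 0 < \det (A x) ->
  is_derive x v (fun y => ln (\det (A y))) (\tr (B x *m A v)).
Proof.
move=> d0; have uA : A x \in unitmx by rewrite unitmxE unitfE gt_eqF.
rewrite -[x in is_derive x](add0r x) -(scale0r v); apply/is_derive_line.
pose M := B x *m A v; pose g (t : R) := \det (A x) * (det1_poly M).[t].
have -> : (fun t : R => ln (\det (A (t *: v + x)))) = @ln R \o g.
  apply/funext => t /=; rewrite /g horner_det1_poly -det_mulmx linA.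
  by rewrite mulmxDr mulmx1 -scalemxAr mulmxA mulmxV// mul1mx addrC.
have g0 : g 0 = \det (A x).
  by rewrite /g horner_det1_poly scale0r addr0 det1 mulr1.
have dg : is_derive (0 : R) 1 g (\det (A x) * \tr M).
  have -> : g = cst (\det (A x)) * horner (det1_poly M) by [].
  apply: is_derive_eq.
  by rewrite /= scaler0 addr0 deriv_det1_poly.
have dl : is_derive (g 0) 1 (@ln R) (\det (A x))^-1.
  by rewrite g0; exact: is_derive1_ln.
have dc := is_derive1_comp dl dg; apply: is_derive_eq.
by rewrite /= /GRing.scale /= mulKf ?gt_eqF.
Qed.

(** By the resolvent identity the increment of the inverse is [- h] times a product, so only
    continuity of the inverse is needed. *)
Lemma mxder_inv x v : A x \in unitmx -> mxder B x v (- (B x *m A v *m B x)).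
Proof.
move=> uA i j; apply: is_derive_cvg.
have cA : mxcvg (0 : R)^' (fun h : R => A (h *: v + x)) (A x).
  move=> k l; have E : (fun h : R => A (h *: v + x) k l) = (fun h => h * A v k l + A x k l).
    by apply/funext => h; rewrite linA !mxE.
  rewrite E -[X in _ --> X]add0r -[X in _ --> X + _](mul0r (A v k l)).
  apply: cvgD; last exact: cvg_cst.
  apply: cvgM; last exact: cvg_cst.
  exact: nbhs_dnbhs.
have F0 : Filter (0 : R)^' by exact: dnbhs_filter.
have cB := @mxcvg_inv _ _ _ F0 _ _ _ cA uA.
have c := @mxcvgM _ _ _ F0 _ _ _ _ _ _ _
  (@mxcvgM _ _ _ F0 _ _ _ _ _ _ _ cB (@mxcvg_cst _ _ _ F0 _ _ (A v)))
  (@mxcvg_cst _ _ _ F0 _ _ (B x)).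
have {}c : - (invmx (A (h *: v + x)) *m A v *m B x) i j @[h --> (0 : R)^'] -->
    - (B x *m A v *m B x) i j by apply: cvgN; exact: c.
rewrite [X in _ --> X]mxE; apply: (cvg_trans _ c).
apply: (@near_eq_cvg _ _ _ F0).
near=> h.
have h0 : h != 0 by near: h; exact: nbhs_dnbhs_neq.
have uh : A (h *: v + x) \in unitmx by near: h; exact: mxcvg_unit cA uA.
rewrite /B.
have E : invmx (A (h *: v + x)) - invmx (A x) =
   (- h) *: (invmx (A (h *: v + x)) *m A v *m invmx (A x)).
  have -> : (- h) *: (invmx (A (h *: v + x)) *m A v *m invmx (A x)) =
    invmx (A (h *: v + x)) *m (A x - A (h *: v + x)) *m invmx (A x).
    by rewrite linA opprD addrCA subrr addr0 mulmxN mulNmx -scalemxAr -scalemxAl scaleNr.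
  by rewrite mulmxBr mulmxBl mulVmx// mul1mx mulmxK.
have := congr1 (fun M : 'M[R]_L => h^-1 *: M i j) E; rewrite !mxE => ->.
by rewrite /= /GRing.scale /= mulNr mulrN mulKf.
Unshelve. all: by end_near. Qed.

End LogDet.

(** * Derivatives up to order three on a set *)

Section Jets.
Variables (R : realType) (V : normedModType R) (O : set V).

(* [G1 u], [G2 u v], [G3 u v w] are the iterated directional derivatives of [F]
   on [O], in the order [u], [v], [w]. *)
Definition jet3 (F : V -> R) (G1 : V -> V -> R) (G2 : V -> V -> V -> R)
    (G3 : V -> V -> V -> V -> R) : Prop :=
  forall x, O x -> forall u v w,
  [/\ is_derive x u F (G1 u x), is_derive x v (G1 u) (G2 u v x)
    & is_derive x w (G2 u v) (G3 u v w x)] /\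
  [/\ {for x, continuous F}, {for x, continuous (G1 u)},
      {for x, continuous (G2 u v)} & {for x, continuous (G3 u v w)}].

Lemma jet3D F F' G1 G1' G2 G2' G3 G3' : jet3 F G1 G2 G3 -> jet3 F' G1' G2' G3' ->
  jet3 (fun x => F x + F' x) (fun u x => G1 u x + G1' u x)
    (fun u v x => G2 u v x + G2' u v x) (fun u v w x => G3 u v w x + G3' u v w x).
Proof.
move=> jF jF' x Ox u v w.
have [[d1 d2 d3] [c0 c1 c2 c3]] := jF x Ox u v w.
have [[d1' d2' d3'] [c0' c1' c2' c3']] := jF' x Ox u v w.
by split; split; [exact: is_deriveD..|exact: cvgD|exact: cvgD|exact: cvgD|exact: cvgD].
Qed.

Lemma jet3N F G1 G2 G3 : jet3 F G1 G2 G3 ->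
  jet3 (fun x => - F x) (fun u x => - G1 u x) (fun u v x => - G2 u v x)
    (fun u v w x => - G3 u v w x).
Proof.
move=> jF x Ox u v w; have [[d1 d2 d3] [c0 c1 c2 c3]] := jF x Ox u v w.
by split; split; [exact: is_deriveN..|exact: cvgN|exact: cvgN|exact: cvgN|exact: cvgN].
Qed.

Lemma jet3_sum n (F : 'I_n -> V -> R) G1 G2 G3 :
  (forall i, jet3 (F i) (G1 i) (G2 i) (G3 i)) ->
  jet3 (fun x => \sum_(i < n) F i x) (fun u x => \sum_(i < n) G1 i u x)
    (fun u v x => \sum_(i < n) G2 i u v x) (fun u v w x => \sum_(i < n) G3 i u v w x).
Proof.
move=> jF x Ox u v w; split; split; try apply: is_derive_bigsum => i;
  try (apply: cvg_sum => i _); by have [[? ? ?] [? ? ? ?]] := jF i x Ox u v w.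
Qed.

Hypothesis openO : open O.

Let nearO x : O x -> \forall y \near x, O y.
Proof. by move=> Ox; apply: open_nbhs_nbhs; split. Qed.

Lemma jet3_eq_on F F' G1 G2 G3 : (forall x, O x -> F x = F' x) ->
  jet3 F G1 G2 G3 -> jet3 F' G1 G2 G3.
Proof.
move=> FF' jF x Ox u v w; have [[d1 d2 d3] [c0 c1 c2 c3]] := jF x Ox u v w.
have nF : \forall y \near x, F y = F' y by apply: filterS (nearO Ox).
split; split => //; first exact: near_eq_is_derive d1.
rewrite /prop_for /continuous_at -(FF' _ Ox); apply: cvg_trans c0.
exact: near_eq_cvg.
Qed.

Section Derivatives.
Local Open Scope convex_scope.
Variables (F : V -> R) (G1 : V -> V -> R) (G2 : V -> V -> V -> R)
  (G3 : V -> V -> V -> V -> R).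
Hypothesis jF : jet3 F G1 G2 G3.

Lemma jet3_derive1 u x : O x -> 'D_u F x = G1 u x.
Proof. by move=> Ox; have [[d _ _] _] := jF Ox u u u; exact: derive_val. Qed.

Lemma jet3_is_derive2 u v x : O x -> is_derive x v ('D_u F) (G2 u v x).
Proof.
move=> Ox; have [[_ d _] _] := jF Ox u v v; apply: near_eq_is_derive d.
by apply: filterS (nearO Ox) => y /jet3_derive1.
Qed.

Lemma jet3_derive2 u v x : O x -> 'D_v ('D_u F) x = G2 u v x.
Proof. by move=> Ox; have d := jet3_is_derive2 u v Ox; exact: derive_val. Qed.

Lemma jet3_is_derive3 u v w x : O x -> is_derive x w ('D_v ('D_u F)) (G3 u v w x).
Proof.
move=> Ox; have [[_ _ d] _] := jF Ox u v w; apply: near_eq_is_derive d.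
by apply: filterS (nearO Ox) => y /jet3_derive2.
Qed.

Lemma jet3_derive3 u v w x : O x -> 'D_w ('D_v ('D_u F)) x = G3 u v w x.
Proof. by move=> Ox; have d := jet3_is_derive3 u v w Ox; exact: derive_val. Qed.

Lemma jet3_C3_on : C3_on O F.
Proof.
have cont (f g : V -> R) : (forall x, O x -> g x = f x) ->
    (forall x, O x -> {for x, continuous g}) -> {within O, continuous f}.
  move=> fg cg; rewrite continuous_open_subspace// => x /set_mem Ox.
  rewrite /continuous_at -(fg _ Ox); apply: cvg_trans (cg _ Ox).
  by apply: near_eq_cvg; apply: filterS (nearO Ox) => y /fg.
move=> u v w; split; split.
- by move=> x /set_mem Ox; have [[[]]] := jF Ox u v w.
- by move=> x /set_mem Ox; have [] := jet3_is_derive2 u v Ox.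
- by move=> x /set_mem Ox; have [] := jet3_is_derive3 u v w Ox.
- by apply: (cont F F) => // x Ox; have [_ []] := jF Ox u v w.
- apply: (cont _ (G1 u)) => x Ox; first by rewrite jet3_derive1.
  by have [_ []] := jF Ox u v w.
- apply: (cont _ (G2 u v)) => x Ox; first by rewrite jet3_derive2.
  by have [_ []] := jF Ox u v w.
- apply: (cont _ (G3 u v w)) => x Ox; first by rewrite jet3_derive3.
  by have [_ []] := jF Ox u v w.
Qed.

(** Restricted to a segment, [F] has nonnegative second derivative. *)
Lemma jet3_convex_on :
    (forall x y, O x -> O y -> forall t : R, 0 <= t <= 1 ->
      O (t *: x + (1 - t) *: y)) ->
    (forall x h, O x -> 0 <= G2 h h x) ->
  convex_on O F.
Proof.
move=> cO G2_ge0 x y Ox Oy t t01.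
pose v := x - y; pose f (s : R) := F (s *: v + y).
have Os (s : R) : 0 <= s <= 1 -> O (s *: v + y).
  move=> s01; have := cO x y Ox Oy s s01; congr O.
  by rewrite /v scalerBr scalerBl scale1r addrA addrAC.
have df (s : R) : 0 <= s <= 1 -> is_derive s 1 f (G1 v (s *: v + y)).
  move=> s01; have [[d _ _] _] := jF (Os _ s01) v v v.
  exact: (is_derive_line F y v s _).1 d.
have d2f (s : R) : 0 < s < 1 -> is_derive s 1 ('D_1 f) (G2 v v (s *: v + y)).
  move=> s01; apply: (@near_eq_is_derive _ _ _ (fun s : R => G1 v (s *: v + y))).
    near=> z; have z01 : 0 <= z <= 1.
      apply/andP; split; apply: ltW; near: z.
        by apply: lt_nbhsr; case/andP: s01.
      by apply: lt_nbhsl; case/andP: s01.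
    by have d := df z z01; rewrite derive_val.
  have s01' : 0 <= s <= 1 by case/andP: s01 => /ltW -> /ltW ->.
  have [[_ d _] _] := jF (Os _ s01') v v v.
  exact: (is_derive_line (G1 v) y v s _).1 d.
(* The endpoint [0] gets weight [1 - t], because [f 0 = F y] and [f 1 = F x]. *)
have t01' : 0 <= 1 - t <= 1 by lra.
have cf (s : R) : 0 <= s <= 1 -> {for s, continuous f}.
  move=> s01; apply/differentiable_continuous/derivable1_diffP.
  by have [] := df s s01.
case/andP: t01' => s0 s1.
have f2 : f ((0 : R^o) <| Itv01 s0 s1 |> (1 : R^o)) <=
    ((f 0 : R^o) <| Itv01 s0 s1 |> (f 1 : R^o)).
  apply: (@second_derivative_convex R f 0 1) => //.
  - move=> z z01; have d := d2f z z01; rewrite derive_val.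
    by apply: G2_ge0; apply: Os; case/andP: z01 => /ltW -> /ltW ->.
  - by apply: cvg_at_left_filter; apply: cf; rewrite ler01 lexx.
  - by apply: cvg_at_right_filter; apply: cf; rewrite ler01 lexx.
  - move=> z; rewrite in_itv /= => /andP[/ltW z0 /ltW z1].
    by have [] := df z; rewrite ?z0.
  - by move=> z; rewrite in_itv /= => /d2f [].
move: f2; rewrite !convRE /= /unstable.onem subKr mulr0 add0r mulr1 /f.
have -> : t *: v + y = t *: x + (1 - t) *: y.
  by rewrite scalerBr scalerBl scale1r addrA addrAC.
by rewrite scale0r add0r scale1r /v subrK => h; rewrite [leRHS]addrC.
Unshelve. all: by end_near. Qed.

End Derivatives.
End Jets.

Section LogDetJet.
Variables (R : realType) (V : normedModType R) (L : nat) (A : V -> 'M[R]_L).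
Hypotheses (linA : forall a x y, A (a *: x + y) = a *: A x + A y)
  (contA : forall i j, continuous (fun x => A x i j)).

(** Everything follows from the rule that the derivative of [C z] along [w] is [- (C w *m C z)]. *)
Lemma lndet_jet3 (O : set V) : (forall x, O x -> 0 < \det (A x)) ->
  let C u x := invmx (A x) *m A u in
  jet3 O (fun x => ln (\det (A x))) (fun u x => \tr (C u x))
    (fun u v x => - \tr (C v x *m C u x))
    (fun u v w x => \tr (C w x *m C v x *m C u x) + \tr (C v x *m C w x *m C u x)).
Proof.
move=> detA C x Ox u v w.
have uA : A x \in unitmx by rewrite unitmxE unitfE gt_eqF// detA.
have derC z w' : mxder (C z) x w' (- (C w' x *m C z x)).
  have := mxderM (mxder_inv linA w' uA) (mxder_cst (A z) x w').
  by rewrite mulmx0 addr0 mulNmx /C !mulmxA.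
have cA : mxcvg (nbhs x) A (A x) by move=> i j; exact: contA.
have cC z : mxcvg (nbhs x) (C z) (C z x).
  by apply: mxcvgM; [exact: mxcvg_inv|exact: mxcvg_cst].
split; split.
- exact: is_derive_lndet (detA _ Ox).
- by have := mxder_trace (derC u v); rewrite raddfN.
- have /is_deriveN := mxder_trace (mxderM (derC v w) (derC u w)).
  rewrite mxtraceD mulNmx mulmxN !raddfN /= opprD !opprK.
  by rewrite !mulmxA.
- by apply: cvg_comp (mxcvg_det cA) _; exact: continuous_ln (detA _ Ox).
- exact: mxcvg_trace.
- by apply: cvgN; apply: mxcvg_trace; exact: mxcvgM.
- by apply: cvgD; apply: mxcvg_trace; do 2 (apply: mxcvgM => //).
Qed.

End LogDetJet.

(** * Openness, closure and concavity of [ln det] for positive definite matrices *)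

Section PosdefAnalysis.
Variable R : realType.

Lemma posdef_det_gt0 L (A : 'M[R]_L) : posdef A -> 0 < \det A.
Proof.
move=> pA; have [C uC ->] := cholesky pA.
rewrite det_mulmx det_tr -expr2 exprn_even_gt0//=.
by rewrite -unitfE -unitmxE.
Qed.

(** With [y = C *m x] the form of [B] at [x] is [fro y] plus the form of [M] at [y], which is
    smaller than [fro y] in absolute value. *)
Lemma posdef_perturb L (C B : 'M[R]_L) : C \in unitmx -> B^T = B ->
  fro ((invmx C)^T *m (B - C^T *m C) *m invmx C) < 1 -> posdef B.
Proof.
move=> uC sB; set M := _ *m _ *m _ => M1; split=> // x x0.
pose y := C *m x.
have y0 : y != 0 by apply: contra x0 => /eqP h; rewrite -(mulKmx uC x) -/y h mulmx0.
have -> : x^T *m B *m x = y^T *m y + y^T *m M *m y.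
  rewrite /M /y trmx_mul !mulmxA -(mulmxA x^T C^T (invmx C)^T) -(trmx_mul (invmx C) C).
  rewrite mulVmx// trmx1 mulmx1.
  by rewrite -(mulmxA _ (invmx C) C) mulVmx// mulmx1 mulmxBr mulmxBl !mulmxA addrC subrK.
have yy : (y^T *m y) 0 0 = fro y.
  by rewrite -fro_trmx fro_trace trmxK /mxtrace big_ord1.
have fy0 : 0 < fro y.
  have [|_ /(_ y y0)] := @posdef_gram R L L 1%:M; first by move=> z; rewrite mul1mx.
  by rewrite trmx1 mulmx1 mulmx1 yy.
rewrite mxE yy -ltrBlDl sub0r.
have : `|(y^T *m M *m y) 0 0| < fro y; last by rewrite ltr_norml => /andP[].
have : ((y^T *m M *m y) 0 0) ^+ 2 < (fro y) ^+ 2.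
  have -> : (y^T *m M *m y) 0 0 = \tr (M *m (y *m y^T)).
    by rewrite (mulmxA M y) mxtrace_mulC (mulmxA y^T M) /mxtrace big_ord1.
  apply: le_lt_trans (sqr_mxtrace_mul_le _ _) _.
  apply: le_lt_trans (ler_wpM2l (fro_ge0 _) (fro_mul_le _ _)) _.
  by rewrite fro_trmx -expr2 gtr_pMl// exprn_gt0.
by rewrite -[X in X < _]real_normK ?num_real// ltr_sqr ?nnegrE ?normr_ge0 ?fro_ge0.
Qed.

(** By Cauchy-Schwarz for the semidefinite form, a vector where the form vanishes lies in the kernel
    of [A]. *)
Lemma possemidef_unit_posdef L (A : 'M[R]_L) :
  possemidef A -> A \in unitmx -> posdef A.
Proof.
move=> [sA pA] uA; split=> // x x0; rewrite lt_def pA andbT.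
apply: contra x0 => /eqP q0.
have h (y : 'cV[R]_L) : (y^T *m A *m x) 0 0 = 0.
  apply/eqP; rewrite -sqrf_eq0 eq_le sqr_ge0 andbT.
  rewrite -(mulr0 ((y^T *m A *m y) 0 0)); apply: sqr_le_of_quadratic => // r.
  have := pA (x - r *: y).
  have xy : (x^T *m A *m y) 0 0 = (y^T *m A *m x) 0 0.
    have -> : x^T *m A *m y = (y^T *m A *m x)^T by rewrite !trmx_mul trmxK sA mulmxA.
    by rewrite [LHS]mxE.
  rewrite [(_ - _)^T]linearB /= [(r *: y)^T]linearZ /=.
  rewrite !mulmxBl !mulmxBr -!scalemxAl -!scalemxAr scalerA.
  have EB (M N : 'M[R]_1) : (M - N) 0 0 = M 0 0 - N 0 0 by rewrite !mxE.
  have EZ a (N : 'M[R]_1) : (a *: N) 0 0 = a * N 0 0 by rewrite mxE.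
  by rewrite !EB !EZ q0 xy; lra.
have Ax0 : A *m x = 0.
  apply/colP => i; rewrite [RHS]mxE -[RHS](h (delta_mx i 0)).
  by rewrite trmx_delta -mulmxA -rowE [RHS]mxE.
by apply/eqP; rewrite -(mulKmx uA x) Ax0 mulmx0.
Qed.

End PosdefAnalysis.

Section LinearPosdef.
Variables (R : realType) (V : normedModType R) (L : nat) (A : V -> 'M[R]_L).
Hypotheses (linA : forall a x y, A (a *: x + y) = a *: A x + A y)
  (contA : forall i j, continuous (fun x => A x i j))
  (symA : forall x, (A x)^T = A x).

Lemma linmx0 : A 0 = 0.
Proof. by have := linA (-1) 0 0; rewrite scaler0 addr0 scaleN1r addNr. Qed.

Lemma linmxZ a x : A (a *: x) = a *: A x.
Proof. by rewrite -[a *: x]addr0 linA linmx0 addr0. Qed.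

Lemma near_posdef x : posdef (A x) -> \forall y \near x, posdef (A y).
Proof.
move=> pA; have [C uC AC] := cholesky pA.
have cA : mxcvg (nbhs x) A (A x) by move=> i j; exact: contA.
have : fro ((invmx C)^T *m (A y + (-1) *: (C^T *m C)) *m invmx C) @[y --> x] -->
    fro ((invmx C)^T *m (A x + (-1) *: (C^T *m C)) *m invmx C).
  apply: mxcvg_fro; apply: mxcvgM; last exact: mxcvg_cst.
  apply: mxcvgM; first exact: mxcvg_cst.
  by apply: mxcvgD => //; exact: mxcvg_cst.
move=> /cvgr_lt /(_ 1); rewrite AC scaleN1r subrr mulmx0 mul0mx.
have -> : fro (0 : 'M[R]_L) = 0 by rewrite fro_trace mul0mx mxtrace0.
move=> /(_ ltr01); apply: filterS => y.
exact: posdef_perturb.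
Qed.

Lemma quadform_continuous (x : 'cV[R]_L) : continuous (fun v => (x^T *m A v *m x) 0 0).
Proof.
move=> v; have cA : mxcvg (nbhs v) A (A v) by move=> i j; exact: contA.
have : mxcvg (nbhs v) (fun w => x^T *m A w *m x) (x^T *m A v *m x).
  by apply: mxcvgM; last exact: mxcvg_cst; apply: mxcvgM => //; exact: mxcvg_cst.
exact.
Qed.

Lemma closure_possemidef (O : set V) : (forall x, O x -> posdef (A x)) ->
  forall x, closure O x -> possemidef (A x).
Proof.
move=> OA x clx; split=> // z; rewrite leNgt; apply/negP => neg.
have c := @quadform_continuous z x; have nn : \forall y \near x, (z^T *m A y *m z) 0 0 < 0.
  exact: cvgr_lt c _ neg.
have [y [/OA/posdef_possemidef[_ /(_ z)]]] := clx _ nn.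
by rewrite /= leNgt => /negP.
Qed.

Lemma neg_lndet_convex :
  convex_on [set v | posdef (A v)] (fun v => - ln (\det (A v))).
Proof.
have j := @lndet_jet3 R V L A linA contA [set v | posdef (A v)]
  (fun v => @posdef_det_gt0 R L (A v)).
apply: (jet3_convex_on (jet3N j)).
- by move=> x y /= px py t t01; rewrite linA linmxZ; exact: posdef_conv.
- by move=> x h /= px; rewrite opprK; exact: tr2_ge0.
Qed.

End LinearPosdef.

(** Concavity of [ln det] at the midpoint [X] of [X + Y] and [X - Y]. *)
Lemma det_addmx_submx_le (R : realType) L (X Y : 'M[R]_L) :
    Y^T = Y -> posdef X -> posdef (X + Y) -> posdef (X - Y) ->
  \det (X + Y) * \det (X - Y) <= \det X ^+ 2.
Proof.
move=> sY pX pP pN.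
(* Parametrizing the span of [X] and [Y] keeps every value symmetric. *)
pose A (v : 'rV[R]_2) : 'M[R]_L := v 0 0 *: X + v 0 1 *: Y.
have linA a x y : A (a *: x + y) = a *: A x + A y.
  by apply/matrixP => i j; rewrite /A !mxE; ring.
have contA i j : continuous (fun x => A x i j).
  have -> : (fun x => A x i j) = (fun x => x 0 0 * X i j + x 0 1 * Y i j).
    by apply/funext => x; rewrite /A !mxE.
  move=> x; apply: (@cvgD _ _ _ _ (nbhs_filter x)
    (fun y : 'rV[R]_2 => y 0 0 * X i j) (fun y : 'rV[R]_2 => y 0 1 * Y i j)).
    by apply: (@cvgM _ _ _ (nbhs_filter x) (fun y : 'rV[R]_2 => y 0 0));
      [exact: coord_continuous|exact: cvg_cst].
  by apply: (@cvgM _ _ _ (nbhs_filter x) (fun y : 'rV[R]_2 => y 0 1));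
      [exact: coord_continuous|exact: cvg_cst].
have symA x : (A x)^T = A x by rewrite /A linearD !linearZ /= sY pX.1.
pose v (b : R) : 'rV[R]_2 := \row_j (if j == 0 then 1 else b).
have Av b : A (v b) = X + b *: Y by rewrite /A !mxE /= scale1r.
have h : 0 <= (2^-1 : R) <= 1 by lra.
have := neg_lndet_convex linA contA symA (x := v 1) (y := v (-1)) _ _ h.
rewrite /= linA linmxZ// !Av scale1r scaleN1r => /(_ pP pN).
have -> : 2^-1 *: (X + Y) + (1 - 2^-1) *: (X - Y) = X.
  by apply/matrixP => i j; rewrite !mxE; field.
have dP := posdef_det_gt0 pP; have dN := posdef_det_gt0 pN; have dX := posdef_det_gt0 pX.
move=> le; rewrite -ler_ln ?posrE ?mulr_gt0 ?exprn_gt0//.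
by rewrite lnM ?posrE// lnXn// mulr2n; lra.
Qed.

(** * The cone and its barrier *)

Lemma Lam_linear (R : comNzRingType) U L (P : 'M[R]_(U, L)) a x y :
  Lam P (a *: x + y) = a *: Lam P x + Lam P y.
Proof. by rewrite /Lam !linearP /= mulmxDl -scalemxAl. Qed.

Lemma trmx_Lam (R : comNzRingType) U L (P : 'M[R]_(U, L)) s : (Lam P s)^T = Lam P s.
Proof. by rewrite /Lam !trmx_mul tr_diag_mx trmxK mulmxA. Qed.

Lemma LamE (R : comNzRingType) U L (P : 'M[R]_(U, L)) s i j :
  Lam P s i j = \sum_u P u i * s u 0 * P u j.
Proof.
rewrite /Lam mul_mx_diag mxE; apply: eq_bigr => u _.
by rewrite !mxE.
Qed.

Lemma cvg_ray_right (R : realType) (V : normedModType R) (x v : V) :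
  a *: v + x @[a --> (0 : R)^'+] --> x.
Proof.
apply: cvg_at_right_filter; rewrite -[X in _ --> X]add0r -(scale0r v).
by apply: cvgD; [exact: scalel_continuous|exact: cvg_cst].
Qed.

(** * The cone as a system of linear matrix inequalities *)

Section Blocks.
Variables (R : realType) (U L m : nat) (P : 'M[R]_(U, L)) (hm : (2 <= m)%N).
Local Notation V := 'M[R]_(U, m).
Local Notation i0 := (first_idx hm).
Local Notation X := (Lam1 P hm).
Implicit Types s : 'M[R]_(U, m).

(* The convention [offd s i0 = 0] lets the summand [- ln det (Lam1 s)] of the
   barrier be treated as one more Schur complement term. *)
Definition offd s (i : 'I_m) : 'M[R]_L := if i == i0 then 0 else Lam P (col i s).

Definition pm (b : bool) (i : 'I_m) s : 'M[R]_L :=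
  if b then X s - offd s i else X s + offd s i.

Arguments pm : simpl never.

Lemma Lam1_linear a s s' : X (a *: s + s') = a *: X s + X s'.
Proof. by rewrite /Lam1 linearP Lam_linear. Qed.

Lemma offd_linear i a s s' : offd (a *: s + s') i = a *: offd s i + offd s' i.
Proof.
rewrite /offd; case: ifP => _; first by rewrite scaler0 addr0.
by rewrite linearP Lam_linear.
Qed.

Lemma pm_linear b i a s s' : pm b i (a *: s + s') = a *: pm b i s + pm b i s'.
Proof.
rewrite /pm Lam1_linear offd_linear; case: b.
  by rewrite opprD scalerBr addrACA.
by rewrite scalerDr addrACA.
Qed.

Lemma trmx_offd s i : (offd s i)^T = offd s i.
Proof. by rewrite /offd; case: ifP => _; rewrite ?trmx0 ?trmx_Lam. Qed.

Lemma trmx_pm b i s : (pm b i s)^T = pm b i s.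
Proof.
by rewrite /pm; case: b; rewrite ?linearB ?linearD /= trmx_offd /Lam1 trmx_Lam.
Qed.

Lemma mxcvg_Lam_col (i : 'I_m) s :
  mxcvg (nbhs s) (fun s' => Lam P (col i s')) (Lam P (col i s)).
Proof.
move=> k l; rewrite LamE; under eq_fun do rewrite LamE.
apply: cvg_sum => u _; apply: cvgM; last exact: cvg_cst.
apply: cvgM; first exact: cvg_cst.
by rewrite mxE; under eq_fun do rewrite mxE; exact: coord_continuous.
Qed.

Lemma mxcvg_offd i s : mxcvg (nbhs s) (offd^~ i) (offd s i).
Proof.
rewrite /offd; case: ifP => _; [exact: mxcvg_cst|exact: mxcvg_Lam_col].
Qed.

Lemma mxcvg_pm b i s : mxcvg (nbhs s) (pm b i) (pm b i s).
Proof.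
rewrite /pm; case: b.
  rewrite -scaleN1r; under eq_fun do rewrite -scaleN1r.
  apply: mxcvgD; first exact: mxcvg_Lam_col.
  by apply: mxcvgZ; exact: mxcvg_offd.
by apply: mxcvgD; [exact: mxcvg_Lam_col|exact: mxcvg_offd].
Qed.

Lemma pm_continuous b i k l : continuous (fun s => pm b i s k l).
Proof. by move=> s; exact: mxcvg_pm. Qed.

Lemma pm_i0 b : pm b i0 = X.
Proof. by apply/funext => s; case: b; rewrite /pm /offd eqxx ?subr0 ?addr0. Qed.

(** Linearizes the Schur conditions. At [i0] both signs say that [Lam1] is positive definite, as the
    Schur complements require. *)
Lemma KintP s : Kint P hm s <-> forall b i, posdef (pm b i s).
Proof.
split=> [[pX pS] b i|h].
  have [->|ii0] := eqVneq i i0; first by rewrite pm_i0.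
  have := pS i ii0; rewrite /schur -/(schurc _ _) /pm /offd (negbTE ii0) => pSi.
  have sX := trmx_Lam P (col i0 s); have sY := trmx_Lam P (col i s).
  case: b; first exact: posdef_submx_schurc.
  by apply: posdef_addmx_schurc => //; exact: posdef_unitmx.
have pX : posdef (X s) by have := h true i0; rewrite pm_i0.
split=> // i ii0; have := h true i; have := h false i.
rewrite /pm /offd (negbTE ii0) => pP pN.
by apply: posdef_schurc => //; rewrite ?trmx_Lam ?posdef_unitmx.
Qed.

(** The factorization of the Schur determinant gives each summand; at [i0] two of the three equal
    terms cancel and [- ln det Lam1] remains. *)
Lemma FbarE s : Kint P hm s -> Fbar P hm s =
  \sum_(i < m) (- ln (\det (pm false i s)) - ln (\det (pm true i s)) + ln (\det (X s))).
Proof.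
move=> Ks; have pK := (KintP s).1 Ks; have [pX _] := Ks.
rewrite /Fbar [RHS](bigD1 i0)//= !pm_i0 addrC subrK; congr (_ + _).
rewrite -sumrN; apply: eq_bigr => i ii0.
have pP := pK false i; have pN := pK true i.
have -> : schur P hm s i = schurc (X s) (offd s i).
  by rewrite /schurc /offd (negbTE ii0).
rewrite det_schurc ?posdef_unitmx//; rewrite /pm in pP pN *.
have dP := posdef_det_gt0 pP; have dN := posdef_det_gt0 pN; have dX := posdef_det_gt0 pX.
by rewrite ln_div ?lnM ?posrE ?mulr_gt0//; ring.
Qed.

Lemma Kint_open : open (Kint P hm).
Proof.
rewrite openE => s /KintP Ks.
have : \forall s' \near s, forall (bi : bool * 'I_m), posdef (pm bi.1 bi.2 s').
  apply: (@filter_forall _ (bool * 'I_m)%type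
    (fun bi s' => posdef (pm bi.1 bi.2 s')) (nbhs s) (nbhs_filter s)) => -[b i] /=.
  exact: (near_posdef (@pm_continuous b i) (trmx_pm b i)).
by apply: filterS => s' h; apply/KintP => b i; exact: (h (b, i)).
Qed.

Section Closure.
Hypothesis Kint_neq0 : Kint P hm !=set0.

(** Semidefiniteness survives limits. Conversely, adding [a *: e] with [e] in [Kint] and small
    [a > 0] moves [s] into [Kint]. *)
Lemma Kl1P s : Kl1 P hm s <-> forall b i, possemidef (pm b i s).
Proof.
split=> [clK b i|h].
  apply: (closure_possemidef (@pm_continuous b i) (trmx_pm b i) _ clK).
  by move=> s' /KintP.
have [e /KintP Ke] := Kint_neq0.
move=> B Bs.
have nB := cvg_ray_right e Bs.
near (0 : R)^'+ => a.
have a0 : 0 < a by near: a; exact: nbhs_right_gt.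
exists (a *: e + s); split; last by near: a.
by apply/KintP => b i; rewrite pm_linear addrC; exact: posdefDl (h b i) (posdefZ a0 (Ke b i)).
Unshelve. all: by end_near. Qed.

(** An interior point [s] can be moved by [- a *: e] within the cone; adding the positive definite
    part back makes every block of [s] positive definite. *)
Lemma interior_Kl1 : interior (Kl1 P hm) = Kint P hm.
Proof.
apply/seteqP; split=> [s sK|]; last first.
  by rewrite -open_subsetE; [exact: subset_closure|exact: Kint_open].
have [e /KintP Ke] := Kint_neq0.
have nB := cvg_ray_right (- e) sK.
near (0 : R)^'+ => a.
have a0 : 0 < a by near: a; exact: nbhs_right_gt.
have h : Kl1 P hm (a *: (- e) + s) by near: a.
have {}h := (Kl1P _).1 h.
apply/KintP => b i.
have -> : s = a *: e + (a *: (- e) + s) by rewrite scalerN addNKr.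
by rewrite pm_linear addrC; exact: posdefDl (h b i) (posdefZ a0 (Ke b i)).
Unshelve. all: by end_near. Qed.

End Closure.
End Blocks.

(** * The barrier properties *)

Section Barrier.
Variables (R : realType) (U L m : nat) (P : 'M[R]_(U, L)) (hm : (2 <= m)%N).
Hypothesis Kint_neq0 : Kint P hm !=set0.
Local Notation V := 'M[R]_(U, m).
Local Notation i0 := (first_idx hm).
Local Notation X := (Lam1 P hm).
Local Notation pm := (pm P hm).
Local Notation offd := (offd P hm).
Local Notation K := (Kl1 P hm).
Implicit Types s h : 'M[R]_(U, m).

Lemma Kint_posdef_pm b i s : Kint P hm s -> posdef (pm b i s).
Proof. by move/KintP. Qed.

Lemma Kint_posdef_Lam1 s : Kint P hm s -> posdef (X s).
Proof. by case. Qed.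

Lemma Kl1_closed_convex_cone : closed_convex_cone_int K.
Proof.
split.
- exact: closed_closure.
- move=> s s' /(Kl1P Kint_neq0) h /(Kl1P Kint_neq0) h' t /andP[t0 t1].
  apply/(Kl1P Kint_neq0) => b i; rewrite pm_linear (linmxZ (pm_linear _ _ b i)).
  by apply: possemidefD; apply: possemidefZ; rewrite ?subr_ge0.
- move=> s t /(Kl1P Kint_neq0) h t0; apply/(Kl1P Kint_neq0) => b i.
  by rewrite (linmxZ (pm_linear _ _ b i)); exact: possemidefZ.
- by rewrite interior_Kl1.
Qed.

Lemma Kint_convex s s' : Kint P hm s -> Kint P hm s' ->
  forall t : R, 0 <= t <= 1 -> Kint P hm (t *: s + (1 - t) *: s').
Proof.
move=> /KintP h /KintP h' t t01; apply/KintP => b i.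
by rewrite pm_linear (linmxZ (pm_linear _ _ b i)); exact: posdef_conv.
Qed.

Definition tr2sum s h : R :=
  \sum_(i < m) (tr2 (pm false i s) (pm false i h) + tr2 (pm true i s) (pm true i h)
                - tr2 (X s) (X h)).

Definition tr3sum s h : R :=
  \sum_(i < m) (tr3 (pm false i s) (pm false i h) + tr3 (pm true i s) (pm true i h)
                - tr3 (X s) (X h)).

Lemma tr23sum_bound s h : Kint P hm s ->
  0 <= tr2sum s h /\ tr3sum s h ^+ 2 <= tr2sum s h ^+ 3.
Proof.
move=> Ks.
apply: (@barrier_cubic_le _ _ _ i0 (X s) (X h) (offd s) (offd h)).
- exact: Kint_posdef_Lam1.
- exact: trmx_Lam.
- exact: trmx_offd.
- exact: trmx_offd.
- by rewrite /offd eqxx.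
- by rewrite /offd eqxx.
- by move=> i; exact: (@Kint_posdef_pm false).
- by move=> i; exact: (@Kint_posdef_pm true).
Qed.

(** The jets of the [ln det] terms add up. For equal directions the two orderings in each third
    derivative coincide, hence the factor [2]. *)
Lemma Fbar_jet3 : exists G1 G2 G3, [/\ jet3 (Kint P hm) (Fbar P hm) G1 G2 G3,
  forall s h, G2 h h s = tr2sum s h & forall s h, G3 h h h s = - 2 * tr3sum s h].
Proof.
have jpm b i := lndet_jet3 (pm_linear P hm b i) (@pm_continuous _ _ _ _ P hm b i)
  (fun s Ks => posdef_det_gt0 (Kint_posdef_pm b i Ks)).
have jX := jpm true i0; rewrite pm_i0 in jX.
have j := jet3_sum (fun i => jet3D (jet3D (jet3N (jpm false i)) (jet3N (jpm true i))) jX).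
do 3 eexists; split.
- apply: (jet3_eq_on (@Kint_open _ _ _ _ P hm) _ j) => s Ks.
  by rewrite FbarE.
- by move=> s h /=; apply: eq_bigr => i _; rewrite !opprK.
- move=> s h /=; rewrite /tr3sum mulr_sumr; apply: eq_bigr => i _.
  by rewrite /tr3 /pm; ring.
Qed.

(** Each of the [m] summands contributes [- L - L + L = - L] times [ln tau]. *)
Lemma Fbar_homogeneous s (tau : R) : Kint P hm s -> 0 < tau ->
  Fbar P hm (tau *: s) = Fbar P hm s - (L * m)%:R * ln tau.
Proof.
move=> Ks t0.
have lnZ (A : V -> 'M[R]_L) : (forall a x y, A (a *: x + y) = a *: A x + A y) ->
    posdef (A s) -> ln (\det (A (tau *: s))) = L%:R * ln tau + ln (\det (A s)).
  move=> linA pA; rewrite (linmxZ linA) detZ lnM ?posrE ?exprn_gt0 ?posdef_det_gt0//.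
  by rewrite lnXn// mulr_natl.
have Kt : Kint P hm (tau *: s).
  apply/KintP => b i; rewrite (linmxZ (pm_linear _ _ b i)).
  by apply: posdefZ => //; exact: Kint_posdef_pm.
rewrite !FbarE//.
have -> : (L * m)%:R * ln tau = \sum_(i < m) (L%:R * ln tau).
  by rewrite sumr_const card_ord natrM mulrAC mulr_natr.
rewrite -sumrB; apply: eq_bigr => i _.
have hP := lnZ _ (pm_linear P hm false i) (Kint_posdef_pm false i Ks).
have hN := lnZ _ (pm_linear P hm true i) (Kint_posdef_pm true i Ks).
have hX := lnZ _ (Lam1_linear P hm) (Kint_posdef_Lam1 Ks).
by rewrite hP hN hX; ring.
Qed.

Lemma Fbar_self_concordant s h : Kint P hm s ->
  `|D3 (Fbar P hm) s h| <= 2 * powR (D2 (Fbar P hm) s h) (3 / 2).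
Proof.
move=> Ks; have [G1 [G2 [G3 [j E2 E3]]]] := Fbar_jet3.
rewrite /D3 /D2 (jet3_derive3 (@Kint_open _ _ _ _ P hm) j)//.
rewrite (jet3_derive2 (@Kint_open _ _ _ _ P hm) j)// E2 E3.
have [e0 le] := tr23sum_bound h Ks.
rewrite normrM normrN normr_nat ler_wpM2l//.
(* The power [3 / 2] is the square root of the cube, so the squared inequality suffices. *)
rewrite powRrM powR12_sqrt ?powR_ge0// -[leLHS]sqrtr_sqr ler_wsqrtr//.
by rewrite powR_mulrn.
Qed.

Lemma Fbar_convex : convex_on (Kint P hm) (Fbar P hm).
Proof.
have [G1 [G2 [G3 [j E2 _]]]] := Fbar_jet3.
apply: (jet3_convex_on j); first exact: Kint_convex.
by move=> s h Ks; rewrite E2; have [] := tr23sum_bound h Ks.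
Qed.

Lemma Fbar_C3 : C3_on (Kint P hm) (Fbar P hm).
Proof.
have [G1 [G2 [G3 [j _ _]]]] := Fbar_jet3.
exact: (jet3_C3_on (@Kint_open _ _ _ _ P hm) j).
Qed.

(** On [Kint], the determinant of the [i]-th Schur complement, and that of [Lam1] at [i0]. *)
Definition schurdet (i : 'I_m) s : R :=
  \det (pm false i s) * \det (pm true i s) / \det (X s).

Lemma schurdet_gt0 i s : Kint P hm s -> 0 < schurdet i s.
Proof.
move=> Ks; have dP := posdef_det_gt0 (Kint_posdef_pm false i Ks).
have dN := posdef_det_gt0 (Kint_posdef_pm true i Ks).
have dX := posdef_det_gt0 (Kint_posdef_Lam1 Ks).
by rewrite divr_gt0 ?mulr_gt0.
Qed.

Lemma schurdet_le i s : Kint P hm s -> schurdet i s <= \det (X s).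
Proof.
move=> Ks; have dX := posdef_det_gt0 (Kint_posdef_Lam1 Ks).
rewrite /schurdet ler_pdivrMr// -expr2.
apply: det_addmx_submx_le; first exact: trmx_offd.
- exact: Kint_posdef_Lam1.
- exact: (@Kint_posdef_pm false).
- exact: (@Kint_posdef_pm true).
Qed.

Lemma Fbar_schurdet s : Kint P hm s -> Fbar P hm s = - \sum_(i < m) ln (schurdet i s).
Proof.
move=> Ks; rewrite FbarE// -sumrN; apply: eq_bigr => i _.
have dP := posdef_det_gt0 (Kint_posdef_pm false i Ks).
have dN := posdef_det_gt0 (Kint_posdef_pm true i Ks).
have dX := posdef_det_gt0 (Kint_posdef_Lam1 Ks).
by rewrite /schurdet ln_div ?lnM ?posrE ?mulr_gt0//; ring.
Qed.

(** One logarithm tends to minus infinity, and the others cannot compensate because [schurdet_le]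
    bounds them above. *)
Lemma Fbar_pinfty (xs : nat -> V) (x : V) (j : 'I_m) : (forall k, Kint P hm (xs k)) ->
  xs @ \oo --> x -> schurdet j (xs k) @[k --> \oo] --> (0 : R) ->
  Fbar P hm (xs k) @[k --> \oo] --> +oo.
Proof.
move=> Kxs xsx dj0; apply/cvgryPge => M.
pose D := `|\det (X x)| + 1.
have cX : \det (X (xs k)) @[k --> \oo] --> \det (X x).
  have c : \det (X s) @[s --> x] --> \det (X x).
    exact: mxcvg_det (@mxcvg_Lam_col _ _ _ _ P i0 x).
  exact: (cvg_comp xs (fun s => \det (X s)) xsx c).
pose C := \sum_(i < m | i != j) ln D.
near=> k.
have DX : \det (X (xs k)) <= D.
  near: k; apply: (cvgr_le _ cX); rewrite /D.
  by apply: le_lt_trans (ler_norm _) _; rewrite ltrDl.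
(* The other logarithms sum to at most [C], so this threshold leaves at least [M]. *)
have dj : schurdet j (xs k) <= expR (- M - C).
  by near: k; apply: (cvgr_le _ dj0); exact: expR_gt0.
have Kk := Kxs k.
rewrite Fbar_schurdet// (bigD1 j)//=.
have h1 : ln (schurdet j (xs k)) <= - M - C.
  by rewrite -[leRHS]expRK ler_ln ?posrE ?expR_gt0 ?schurdet_gt0.
have h2 : \sum_(i < m | i != j) ln (schurdet i (xs k)) <= C.
  apply: ler_sum => i _; rewrite ler_ln ?posrE ?schurdet_gt0//.
    exact: le_trans (schurdet_le i Kk) DX.
  by rewrite /D ltr_wpDl.
by lra.
Unshelve. all: by end_near. Qed.

Lemma Fbar_barrier (xs : nat -> V) (x : V) : (forall k, Kint P hm (xs k)) ->
  xs @ \oo --> x -> K x -> ~ Kint P hm x -> Fbar P hm (xs k) @[k --> \oo] --> +oo.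
Proof.
move=> Kxs xsx /(Kl1P Kint_neq0) Kx nKx.
have cX : \det (X (xs k)) @[k --> \oo] --> \det (X x).
  have c : \det (X s) @[s --> x] --> \det (X x).
    exact: mxcvg_det (@mxcvg_Lam_col _ _ _ _ P i0 x).
  exact: (cvg_comp xs (fun s => \det (X s)) xsx c).
have cpm b i : \det (pm b i (xs k)) @[k --> \oo] --> \det (pm b i x).
  have c : \det (pm b i s) @[s --> x] --> \det (pm b i x).
    exact: mxcvg_det (@mxcvg_pm _ _ _ _ P hm b i x).
  exact: (cvg_comp xs (fun s => \det (pm b i s)) xsx c).
(* If [det Lam1] vanishes at the limit, index [i0] works; the quotient in [schurdet] is simplified
   before passing to the limit. *)
have [dX0|dX0] := eqVneq (\det (X x)) 0.
  apply: (@Fbar_pinfty xs x i0) => //; rewrite -dX0; apply: cvg_trans cX.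
  apply: near_eq_cvg; near=> k.
  rewrite /schurdet !pm_i0 mulfK//.
  by rewrite gt_eqF//; exact: posdef_det_gt0 (Kint_posdef_Lam1 (Kxs k)).
(* Otherwise some block is singular: invertible semidefinite blocks would all be positive definite,
   putting [x] in [Kint]. *)
have [[b i] /= bi] : exists bi : bool * 'I_m, \det (pm bi.1 bi.2 x) = 0.
  apply: contrapT => h; apply: nKx; apply/KintP => b i.
  apply: possemidef_unit_posdef; first exact: Kx.
  by rewrite unitmxE unitfE; apply/eqP => h0; apply: h; exists (b, i).
apply: (@Fbar_pinfty xs x i) => //.
have -> : 0 = \det (pm false i x) * \det (pm true i x) / \det (X x).
  by case: b bi => ->; rewrite ?(mulr0, mul0r).
by apply: cvgM; [exact: cvgM|exact: cvgV].
Unshelve. all: by end_near. Qed.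

Theorem Fbar_LHSCB : LHSCB (L * m)%:R K (Fbar P hm).
Proof.
split; split; rewrite ?interior_Kl1//.
- exact: Kl1_closed_convex_cone.
- exact: Fbar_C3.
- exact: Fbar_convex.
- exact: Fbar_barrier.
- by move=> s h; exact: Fbar_self_concordant.
- by move=> s tau; exact: Fbar_homogeneous.
Qed.

End Barrier.

(** * Nonempty interior from unisolvence *)

Lemma Kint_nonempty (R : realType) (U L m : nat) (P : 'M[R]_(U, L)) (hm : (2 <= m)%N) :
  (forall x : 'cV[R]_L, P *m x = 0 -> x = 0) -> Kint P hm !=set0.
Proof.
(* The first column is all ones and the others vanish, so [Lam1] is the Gram matrix of [P]. *)
move=> injP; exists (\matrix_(u, j) (j == first_idx hm)%:R); apply/KintP => b i.
have pX : posdef (Lam1 P hm (\matrix_(u, j) (j == first_idx hm)%:R)).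
  suff -> : Lam1 P hm (\matrix_(u, j) (j == first_idx hm)%:R) = P^T *m P.
    exact: posdef_gram.
  apply/matrixP => k l; rewrite /Lam1 LamE mxE; apply: eq_bigr => u _.
  by rewrite !mxE eqxx mulr1.
have offd0 : offd P hm (\matrix_(u, j) (j == first_idx hm)%:R) i = 0.
  rewrite /offd; case: ifP => // ii0; apply/matrixP => k l; rewrite LamE mxE.
  by apply: big1 => u _; rewrite !mxE ii0 mulr0 mul0r.
by rewrite /pm offd0 subr0 addr0 if_same.
Qed.

Lemma deg_leP (R : nzRingType) n k (p : mpoly.mpoly n R) :
  deg_le k p <-> forall mon, (k < mpoly.mdeg mon)%N -> mpoly.mcoeff mon p = 0.
Proof.
rewrite /deg_le; split=> [/allP h mon kmon|h].
  apply/eqP; apply: contraTT kmon; rewrite -mpoly.mcoeff_msupp => /h.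
  by rewrite -leqNgt.
apply/allP => mon; rewrite mpoly.mcoeff_msupp; apply: contraNT.
by rewrite -ltnNge => /h ->.
Qed.

(** A kernel vector gives a combination of the [p l], of degree at most [d <= 2 * d], vanishing at
    all points; it is zero by unisolvence, and independence kills its coefficients. *)
Lemma Pmat_inj (R : fieldType) n d U L (t : 'I_U -> 'I_n -> R)
    (p : 'I_L -> mpoly.mpoly n R) :
  unisolvent (2 * d) t -> is_basis_polys d p ->
  forall x : 'cV[R]_L, Pmat t p *m x = 0 -> x = 0.
Proof.
move=> ht [degp freep _] x Px0; apply/colP => l; rewrite [RHS]mxE.
apply: (freep (fun l => x l 0)); apply: ht.
  apply/deg_leP => mon dmon; rewrite raddf_sum /=; apply: big1 => k _.
  rewrite mpoly.mcoeffZ; have /deg_leP -> := degp k; first by rewrite mulr0.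
  by apply: leq_ltn_trans dmon; rewrite leq_pmull.
move=> u; have /colP/(_ u) := Px0; rewrite !mxE => <-; rewrite raddf_sum /=.
by apply: eq_bigr => k _; rewrite mpoly.mevalZ mxE mulrC.
Qed.

Theorem theorem2 (R : realType) (n d : nat) (hn : (1 <= n)%N) (hd : (1 <= d)%N)
    (t : 'I_('C(n + 2 * d, n)) -> 'I_n -> R)
    (p : 'I_('C(n + d, n)) -> mpoly.mpoly n R)
    (ht : unisolvent (2 * d) t)
    (hp : is_basis_polys d p)
    (m : nat) (hm : (2 <= m)%N) :
  let P := Pmat t p in
  interior (Kl1 P hm) = Kint P hm /\
  LHSCB ('C(n + d, n) * m)%:R (Kl1 P hm) (Fbar P hm).
Proof.
move=> P; have Kint_neq0 := Kint_nonempty hm (Pmat_inj ht hp).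
by split; [exact: interior_Kl1|exact: Fbar_LHSCB].
Qed.
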